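(* Let $(A_\mu,B_\nu,\vartriangleright,\vartriangleleft,\rightharpoonup,\leftharpoonup,\theta)$ be a quasi-twilled associative algebra over a field of characteristic $0$ and let $r:B\to A$ be a weak deformation map in it. Let $\mathfrak b=\bigoplus_{n\ge0}\mathfrak b_n$, $\mathfrak b_n=\mathrm{Hom}(B^{\otimes n+1},A)$, and for $f,g,h\in\mathfrak b$ put $l_1(f)=[\nu_{\rightharpoonup,\leftharpoonup},f]$, $l_2(f,g)=[[\mu_{\vartriangleright,\vartriangleleft},f],g]$, $l_3(f,g,h)=[[[\widetilde\theta,f],g],h]$. Then $(\mathfrak b,\{l_k^r\}_{k=1}^\infty)$ is an $L_\infty$-algebra, where for $f,g,h\in\mathfrak b$, $$l_1^r(f)=l_1(f)+l_2(r,f)+\tfrac12 l_3(r,r,f),\quad l_2^r(f,g)=l_2(f,g)+l_3(r,f,g),\quad l_3^r(f,g,h)=l_3(f,g,h),\quad l_k^r=0\ (k\ge4).$$ Moreover, for any linear map $r':B\to A$, the sum $r+r':B\to A$ is also a weak deformation map in the given quasi-twilled associative algebra if and only if $r'\in\mathfrak b_0$ is a Maurer-Cartan element of the $L_\infty$-algebra $(\mathfrak b,\{l_k^r\}_{k=1}^\infty)$.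
   Context: A quasi-twilled associative algebra is an associative algebra with a fixed vector space decomposition $\mathbb A=A\oplus B$ such that $B$ is a subalgebra. Its multiplication has the form $(a,x)\cdot_{\mathbb A}(b,y)=(a\cdot_A b+a\leftharpoonup y+x\rightharpoonup b,\ x\cdot_B y+a\vartriangleright y+x\vartriangleleft b+\theta(a,b))$ for unique bilinear maps $\mu=\cdot_A:A\times A\to A$, $\nu=\cdot_B:B\times B\to B$, $\vartriangleright:A\times B\to B$, $\vartriangleleft:B\times A\to B$, $\rightharpoonup:B\times A\to A$, $\leftharpoonup:A\times B\to A$, $\theta:A\times A\to B$; one writes it as the tuple $(A_\mu,B_\nu,\vartriangleright,\vartriangleleft,\rightharpoonup,\leftharpoonup,\theta)$. Put $\widetilde\theta((a,x),(b,y))=(0,\theta(a,b))$, $\mu_{\vartriangleright,\vartriangleleft}((a,x),(b,y))=(a\cdot_A b,\ a\vartriangleright y+x\vartriangleleft b)$ and $\nu_{\rightharpoonup,\leftharpoonup}((a,x),(b,y))=(a\leftharpoonup y+x\rightharpoonup b,\ x\cdot_B y)$. A weak deformation map is a linear map $r:B\to A$ with $r(x)\cdot_A r(y)+r(x)\leftharpoonup y+x\rightharpoonup r(y)=r\big(x\cdot_B y+r(x)\vartriangleright y+x\vartriangleleft r(y)+\theta(r(x),r(y))\big)$ for all $x,y\in B$. Brackets are taken in the graded Lie algebra $\mathfrak g=\bigoplus_{n\ge0}\mathfrak g_n$, $\mathfrak g_n=\mathrm{Hom}((A\oplus B)^{\otimes n+1},A\oplus B)$, with the Gerstenhaber bracket: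 for $f$ with $m$ inputs and $g$ with $n$ inputs, $[f,g]=f\diamond g-(-1)^{(m-1)(n-1)}g\diamond f$, where $(f\diamond g)(v_1,\ldots,v_{m+n-1})=\sum_{i=1}^m(-1)^{(i-1)(n-1)}f(v_1,\ldots,v_{i-1},g(v_i,\ldots,v_{i+n-1}),v_{i+n},\ldots,v_{m+n-1})$. Maps $B^{\otimes n+1}\to A$ are regarded as elements of $\mathfrak g_n$ by extending them by zero, so $\mathfrak b\subset\mathfrak g$. An $L_\infty$-algebra is a graded vector space $\mathcal G$ with graded symmetric (with Koszul sign $\epsilon(\sigma)$) degree $1$ maps $l_k:\mathcal G^{\otimes k}\to\mathcal G$, $k\ge1$, such that for all $N\ge1$ and homogeneous $x_1,\ldots,x_N$: $\sum_{i=1}^N\sum_{\sigma\in Sh(i,N-i)}\epsilon(\sigma)\,l_{N-i+1}(l_i(x_{\sigma(1)},\ldots,x_{\sigma(i)}),x_{\sigma(i+1)},\ldots,x_{\sigma(N)})=0$, where $Sh(i,N-i)$ is the set of $(i,N-i)$-shuffles. A Maurer-Cartan element is $\alpha\in\mathcal G_0$ with $\sum_{k\ge1}\frac1{k!}l_k(\alpha,\ldots,\alpha)=0$. *)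

(* Defs.v *)
From HB Require Import structures.
From mathcomp Require Import all_boot all_order all_fingroup all_algebra.
From mathcomp Require Import sesquilinear zify.
From mathcomp Require Import boolp functions.

Set Implicit Arguments.
Unset Strict Implicit.
Unset Printing Implicit Defensive.

Import GRing.Theory.
Local Open Scope ring_scope.

(* A map V^{(x) n} -> W is encoded as a function on lists that is supported on
   the lists of length n and linear in every slot of such a list. *)
Definition multilinear (K : fieldType) (V W : lmodType K) (n : nat)
    (f : seq V -> W) : Prop :=
  (forall s, size s != n -> f s = 0) /\
  (forall s1 s2 (a : K) (u v : V), (size s1 + (size s2).+1)%N = n ->
     f (s1 ++ (a *: u + v) :: s2) = a *: f (s1 ++ u :: s2) + f (s1 ++ v :: s2)).

Definition unary_map (V : Type) (W : zmodType) (f : V -> W) (s : seq V) : W :=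
  if s is [:: u] then f u else 0.

Definition binary_map (V : Type) (W : zmodType) (f : V -> V -> W)
    (s : seq V) : W :=
  if s is [:: u; v] then f u v else 0.

Section Gerstenhaber.
Variables (K : fieldType) (V : lmodType K).
Implicit Types f g : seq V -> V.

(* f <> g for f with m inputs and g with n inputs; the index i starts at 0. *)
Definition gcirc (m n : nat) f g : seq V -> V := fun s =>
  if size s == (m + n).-1 then
    \sum_(0 <= i < m) (-1) ^+ (i * n.-1) *:
      f (take i s ++ g (take n (drop i s)) :: drop (i + n) s)
  else 0.

Definition gbracket_arity (m n : nat) f g : seq V -> V :=
  gcirc m n f g - (-1) ^+ (m.-1 * n.-1) *: gcirc n m g f.

(* Bilinear extension of the bracket to maps with components of several
   arities: on a list of length N it adds up the brackets of the m-ary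
   component of f with the n-ary component of g, over all m, n >= 1 such that
   m + n - 1 = N; see gbracket_homogeneous. *)
Definition gbracket f g : seq V -> V := fun s =>
  \sum_(1 <= m < (size s).+1) gbracket_arity m (size s - m).+1 f g s.

Lemma gcirc_eq0 m n p q f g s :
  multilinear m f -> multilinear n g -> (0 < p)%N -> (0 < q)%N ->
  (p != m) || (q != n) -> gcirc p q f g s = 0.
Proof.
move=> [f0 fL] [g0 _] p0 q0 pq; rewrite /gcirc; case: eqP => // sE.
rewrite big_nat; apply: big1 => i ip.
have [pm|pm] := eqVneq p m; last first.
  rewrite f0 ?scaler0 //.
  by rewrite size_cat /= size_drop size_take; case: ifP; lia.
rewrite pm eqxx /= in pq; rewrite g0; last first.
  by rewrite size_take size_drop; case: ifP; lia.
set s1 := take _ _; set s2 := drop _ _.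
have [sm|sm] := eqVneq (size (s1 ++ 0 :: s2)) m; last by rewrite f0 ?scaler0.
rewrite size_cat /= in sm; have := fL s1 s2 1 0 0 sm.
rewrite !scale1r addr0 => /(congr1 (fun x => x - f (s1 ++ 0 :: s2))).
by rewrite subrr addrK => <-; rewrite scaler0.
Qed.

Lemma gbracket_homogeneous m n f g :
  multilinear m f -> multilinear n g -> (0 < m)%N -> (0 < n)%N ->
  gbracket f g = gbracket_arity m n f g.
Proof.
move=> fm gn m0 n0; apply/funext => s; rewrite /gbracket.
have z p q : (0 < p)%N -> (0 < q)%N -> (p != m) || (q != n) ->
    gbracket_arity p q f g s = 0.
  move=> p0 q0 pq; rewrite /gbracket_arity !fctE.
  rewrite (gcirc_eq0 _ fm gn) // (gcirc_eq0 _ gn fm) 1?orbC //.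
  by rewrite scaler0 subr0.
have [sE|sE] := eqVneq (size s) (m + n).-1; last first.
  have -> : gbracket_arity m n f g s = 0.
    rewrite /gbracket_arity !fctE /gcirc (addnC n m) (negbTE sE).
    by rewrite scaler0 subr0.
  rewrite big_nat; apply: big1 => p ps; apply: z; lia.
rewrite (bigD1_seq m) ?mem_index_iota ?iota_uniq //=; last by lia.
have -> : (size s - m).+1 = n by lia.
rewrite [X in _ + X]big1_seq ?addr0 // => p /andP[pm].
by rewrite mem_index_iota => ps; apply: z; rewrite ?pm //; lia.
Qed.

End Gerstenhaber.

(* A product on A (+) B, with underlying space A * B, having the form qt_mul.
   By qt_mul_surj these are exactly the associative products on A (+) B for
   which B is a subalgebra. *)
Record quasi_twilled (K : fieldType) (A B : lmodType K) := QuasiTwilled {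
  qt_mu : {bilinear A -> A -> A};
  qt_nu : {bilinear B -> B -> B};
  qt_tr : {bilinear A -> B -> B};   (* a |> y *)
  qt_tl : {bilinear B -> A -> B};   (* x <| b *)
  qt_hr : {bilinear B -> A -> A};   (* right harpoon, B acting on A *)
  qt_hl : {bilinear A -> B -> A};   (* left harpoon, B acting on A *)
  qt_theta : {bilinear A -> A -> B};
  qt_mul := fun u v : A * B =>
    (qt_mu u.1 v.1 + qt_hl u.1 v.2 + qt_hr u.2 v.1,
     qt_nu u.2 v.2 + qt_tr u.1 v.2 + qt_tl u.2 v.1 + qt_theta u.1 v.1);
  qt_mulA : associative qt_mul }.

Section QuasiTwilled.
Variables (K : fieldType) (A B : lmodType K).

Lemma qt_mul_surj (m : {bilinear A * B -> A * B -> A * B}) :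
  associative m -> (forall x y : B, (m (0, x) (0, y)).1 = 0) ->
  exists Q : quasi_twilled A B, qt_mul Q =2 m.
Proof.
move=> mA mB.
have bil (U U' W : lmodType K) (i : {linear U -> (A * B)%type})
    (j : {linear U' -> (A * B)%type}) (p : {linear (A * B)%type -> W}) :
    {h : {bilinear U -> U' -> W} | forall u u', h u u' = p (m (i u) (j u'))}.
  pose h u u' := p (m (i u) (j u')).
  have hP : bilinear_for *:%R *:%R h.
    split=> [u'|u] a x y; rewrite /h /applyr /=.
      by rewrite linearP linearPl linearP.
    by rewrite linearP linearPr linearP.
  pose hB := bilinear_isBilinear.Build K U U' W *:%R *:%R h hP.
  pose hh : {bilinear U -> U' -> W} := HB.pack h hB.
  by exists hh.
have inA_lin : linear (fun a : A => (a, 0 : B)).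
  by move=> k a b; congr (_, _); rewrite /= scaler0 addr0.
have inB_lin : linear (fun x : B => (0 : A, x)).
  by move=> k a b; congr (_, _); rewrite /= scaler0 addr0.
pose iA : {linear A -> (A * B)%type} := HB.pack (fun a : A => (a, 0 : B))
  (GRing.isLinear.Build _ _ _ _ _ inA_lin).
pose iB : {linear B -> (A * B)%type} := HB.pack (fun x : B => (0 : A, x))
  (GRing.isLinear.Build _ _ _ _ _ inB_lin).
have [mu muE] := bil _ _ _ iA iA (fst : {linear (A * B)%type -> A}).
have [nu nuE] := bil _ _ _ iB iB (snd : {linear (A * B)%type -> B}).
have [tr trE] := bil _ _ _ iA iB (snd : {linear (A * B)%type -> B}).
have [tl tlE] := bil _ _ _ iB iA (snd : {linear (A * B)%type -> B}).
have [hr hrE] := bil _ _ _ iB iA (fst : {linear (A * B)%type -> A}).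
have [hl hlE] := bil _ _ _ iA iB (fst : {linear (A * B)%type -> A}).
have [th thE] := bil _ _ _ iA iA (snd : {linear (A * B)%type -> B}).
have mE u v : (mu u.1 v.1 + hl u.1 v.2 + hr u.2 v.1,
    nu u.2 v.2 + tr u.1 v.2 + tl u.2 v.1 + th u.1 v.1) = m u v.
  have dec (w : A * B) : w = iA w.1 + iB w.2.
    by case: w => a x; congr (_, _); rewrite /= ?addr0 ?add0r.
  rewrite [in RHS](dec u) [in RHS](dec v) linearDl !linearDr.
  rewrite muE nuE trE tlE hrE hlE thE.
  apply/eqP; rewrite xpair_eqE; apply/andP; split; apply/eqP => /=.
    by rewrite mB addr0.
  by rewrite addrC -!addrA; congr (_ + _); rewrite addrC -addrA.
have A' : associative (fun u v : A * B =>
   (mu u.1 v.1 + hl u.1 v.2 + hr u.2 v.1,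
    nu u.2 v.2 + tr u.1 v.2 + tl u.2 v.1 + th u.1 v.1)).
  by move=> u v w; rewrite !mE.
by exists (QuasiTwilled A').
Qed.

(* The three components of the product, as elements of Hom((A (+) B)^{(x) 2},
   A (+) B). *)
Variable Q : quasi_twilled A B.

Definition qt_theta_tilde : seq (A * B) -> A * B :=
  binary_map (fun u v => (0, qt_theta Q u.1 v.1)).

Definition qt_mu_act : seq (A * B) -> A * B :=
  binary_map (fun u v =>
    (qt_mu Q u.1 v.1, qt_tr Q u.1 v.2 + qt_tl Q u.2 v.1)).

Definition qt_nu_act : seq (A * B) -> A * B :=
  binary_map (fun u v =>
    (qt_hl Q u.1 v.2 + qt_hr Q u.2 v.1, qt_nu Q u.2 v.2)).

Definition weak_deformation (r : {linear B -> A}) : Prop :=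
  forall x y : B,
    qt_mu Q (r x) (r y) + qt_hl Q (r x) y + qt_hr Q x (r y) =
    r (qt_nu Q x y + qt_tr Q (r x) y + qt_tl Q x (r y)
       + qt_theta Q (r x) (r y)).

End QuasiTwilled.

(* A graded vector space is given by a family of subspaces G d, d : int, of an
   ambient space E whose sum is direct; the space itself is that sum, total_space G.
   An operation on k elements is a function on lists of length k, and only its
   values on lists of elements of total_space G matter. *)
Section LInfinity.
Variables (K : fieldType) (E : lmodType K).
Implicit Types (G : int -> E -> Prop) (l : seq E -> E).

Definition graded_space G : Prop :=
  [/\ forall d, G d 0,
      forall d (a : K) u v, G d u -> G d v -> G d (a *: u + v) &
      forall (D : seq int) (x : int -> E), uniq D -> (forall d, G d (x d)) ->
        \sum_(d <- D) x d = 0 -> forall d, d \in D -> x d = 0].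

Definition total_space G (u : E) : Prop :=
  exists (n : nat) (d : 'I_n -> int) (x : 'I_n -> E),
    (forall i, G (d i) (x i)) /\ u = \sum_i x i.

(* The Koszul sign of x_1 ... x_N |-> x_{s 1} ... x_{s N}, deg x_i = d i. *)
Definition koszul (N : nat) (d : 'I_N -> int) (s : 'S_N) : K :=
  \prod_(i < N) \prod_(j < N | (i < j)%N && (s j < s i)%N)
    (-1) ^ (d (s i) * d (s j)).

Definition shuffle (N i : nat) (s : 'S_N) : bool :=
  [forall a : 'I_N, forall b : 'I_N,
    (a < b)%N && ((b < i)%N || (i <= a)%N) ==> (s a < s b)%N].

Record L_infinity_algebra G l : Prop := LInfinityAlgebra {
  Linf_graded : graded_space G;
  Linf_multilinear : forall s1 s2 (a : K) u v,
    (forall w, w \in s1 ++ u :: v :: s2 -> total_space G w) ->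
    l (s1 ++ (a *: u + v) :: s2) = a *: l (s1 ++ u :: s2) + l (s1 ++ v :: s2);
  Linf_degree : forall k (d : 'I_k -> int) (x : 'I_k -> E), (0 < k)%N ->
    (forall i, G (d i) (x i)) ->
    G (\sum_i d i + 1) (l [seq x i | i : 'I_k]);
  Linf_symmetric : forall k (d : 'I_k -> int) (x : 'I_k -> E) (s : 'S_k),
    (0 < k)%N -> (forall i, G (d i) (x i)) ->
    l [seq x i | i : 'I_k] = koszul d s *: l [seq x (s i) | i : 'I_k];
  Linf_jacobi : forall N (d : 'I_N -> int) (x : 'I_N -> E), (0 < N)%N ->
    (forall i, G (d i) (x i)) ->
    \sum_(1 <= i < N.+1) \sum_(s : 'S_N | shuffle i s)
      koszul d s *:
        (let y := [seq x (s j) | j : 'I_N] in l (l (take i y) :: drop i y))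
    = 0 }.

(* The sum over k >= 1 is required to have finitely many nonzero terms. *)
Definition maurer_cartan G l (a : E) : Prop :=
  G 0 a /\ exists n : nat,
    (forall k, (n < k)%N -> l (nseq k a) = 0) /\
    \sum_(1 <= k < n.+1) (k`!%:R)^-1 *: l (nseq k a) = 0.

End LInfinity.

Section Twisted.
Variables (K : fieldType) (A B : lmodType K).

(* Extension by zero of maps B^{(x) n} -> A to A (+) B. *)
Definition extend (phi : seq B -> A) : seq (A * B) -> A * B :=
  fun s => (phi (map snd s), 0).

Definition b_graded (d : int) (f : seq (A * B) -> A * B) : Prop :=
  match d with
  | Posz n => exists2 phi : seq B -> A, multilinear n.+1 phi & f = extend phi
  | Negz _ => f = 0
  end.

Variable Q : quasi_twilled A B.
Implicit Types f g h : seq (A * B) -> A * B.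

Definition l1 f := gbracket (qt_nu_act Q) f.
Definition l2 f g := gbracket (gbracket (qt_mu_act Q) f) g.
Definition l3 f g h := gbracket (gbracket (gbracket (qt_theta_tilde Q) f) g) h.

Definition b0_of (r : B -> A) : seq (A * B) -> A * B := extend (unary_map r).

Definition l_twisted (r : B -> A) (s : seq (seq (A * B) -> A * B)) :
    seq (A * B) -> A * B :=
  let r_ := b0_of r in
  match s with
  | [:: f] => l1 f + l2 r_ f + 2%:R^-1 *: l3 r_ r_ f
  | [:: f; g] => l2 f g + l3 r_ f g
  | [:: f; g; h] => l3 f g h
  | _ => 0
  end.

End Twisted.

(* Main.v *)
Require Import Defs.
From HB Require Import structures.
From mathcomp Require Import all_boot all_order all_fingroup all_algebra.
From mathcomp Require Import sesquilinear boolp functions zify ring.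

Set Implicit Arguments.
Unset Strict Implicit.
Unset Printing Implicit Defensive.

Import GRing.Theory.
Local Open Scope ring_scope.

(** The product of a quasi-twilled algebra on A (+) B is the sum of three binary
    maps D 1, D 2 and D 3, given by nu with the harpoons, by mu with the
    triangles, and by theta. Filter the multilinear maps on A (+) B by the
    number of arguments that may be taken in A ([filtered]): D k sits in step k,
    the maps B^n -> A form step 0, and the Gerstenhaber bracket sends steps v
    and w to step v + w - 1 ([gbracket_filtered]). Hence b is abelian,
    bracketing D k with k elements of b lands in b, and bracketing it with more
    of them gives 0. Associativity, read off in each number of arguments from A,
    says that the sum of the [D p, D q] over p + q = N vanishes for every N
    ([qt_comp_sq]).

    The operations are the derived brackets l_k(f_1, ..., f_k) = [...[D k, f_1],
    ..., f_k]. They are graded symmetric by the Jacobi identity, as b is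
    abelian. Bracketing the sum of the [D p, D q] over p + q = N + 1 with f_1,
    ..., f_N and expanding by the Leibniz rule ([nested_leibniz]) gives a signed
    sum over the ways of distributing the f_i over the two factors. Only the
    terms in which one factor is saturated survive, and what remains is twice
    the L-infinity relation for f_1, ..., f_N ([derived_jacobi]). So every
    quasi-twilled algebra Q has an L-infinity algebra
    ([quasi_twilled_L_infinity]), whose Maurer-Cartan elements are the weak
    deformation maps in Q ([maurer_cartan_deformation]).

    The twisted operations are those of another quasi-twilled algebra. The shear
    (a, x) |-> (a + r x, x) maps B onto the graph of r, which is a subalgebra
    exactly because r is a weak deformation map; transporting the product along
    the shear gives a quasi-twilled algebra Q' ([twist_exists]) whose components
    are D 1 + [D 2, r] + [[D 3, r], r] / 2, D 2 + [D 3, r] and D 3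
    ([twist_comp1], [twist_comp2], [twist_comp3]). Its operations are therefore
    the l_k^r. Finally the shear maps the graph of r' onto the graph of r + r',
    so r' is a weak deformation map in Q' if and only if r + r' is one in Q
    ([weak_deformation_twist]). *)

(** * Deciding identities in modules *)

(** Formal linear combinations of the entries of a list of vectors. Two of them
    with the same coefficients have the same value, so an identity in a module
    reduces to one ring identity per vector. *)
Inductive lcomb (R : Type) : Type :=
  LVar of nat | LZero | LAdd of lcomb R & lcomb R | LOpp of lcomb R
| LScale of R & lcomb R.
Arguments LVar {R}.
Arguments LZero {R}.

Section LinearCombinations.
Variables (K : nzRingType) (W : lmodType K).

Fixpoint lcomb_val (e : seq W) (t : lcomb K) : W :=
  match t with
  | LVar i => e`_i
  | LZero => 0
  | LAdd t1 t2 => lcomb_val e t1 + lcomb_val e t2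
  | LOpp t1 => - lcomb_val e t1
  | LScale a t1 => a *: lcomb_val e t1
  end.

Fixpoint lcomb_coef (i : nat) (t : lcomb K) : K :=
  match t with
  | LVar j => if eqn i j then 1 else 0
  | LZero => 0
  | LAdd t1 t2 => lcomb_coef i t1 + lcomb_coef i t2
  | LOpp t1 => - lcomb_coef i t1
  | LScale a t1 => a * lcomb_coef i t1
  end.

Fixpoint same_coefs (n : nat) (t1 t2 : lcomb K) : Prop :=
  if n is n'.+1 then
    lcomb_coef n' t1 = lcomb_coef n' t2 /\ same_coefs n' t1 t2
  else True.

Lemma lcomb_valE e t :
  lcomb_val e t = \sum_(i < size e) lcomb_coef i t *: e`_i.
Proof.
elim: t => [j||t1 IH1 t2 IH2|t IH|a t IH] /=.
- have [je|je] := ltnP j (size e); last first.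
    rewrite nth_default // big1 // => i _; case: eqnP => ij.
      by have := ltn_ord i; rewrite ij ltnNge je.
    by rewrite scale0r.
  rewrite (bigD1 (Ordinal je)) //= eqnE eqxx scale1r big1 ?addr0 // => i ij.
  case: eqP => [ijE|_]; last by rewrite scale0r.
  by rewrite -val_eqE /= ijE eqxx in ij.
- by rewrite big1 // => i _; rewrite scale0r.
- by rewrite IH1 IH2 -big_split; apply: eq_bigr => i _; rewrite scalerDl.
- by rewrite IH -sumrN; apply: eq_bigr => i _; rewrite scaleNr.
- by rewrite IH scaler_sumr; apply: eq_bigr => i _; rewrite scalerA.
Qed.

Lemma lcomb_eq e t1 t2 :
  same_coefs (size e) t1 t2 -> lcomb_val e t1 = lcomb_val e t2.
Proof.
move=> h; rewrite !lcomb_valE; apply: eq_bigr => -[i /= ie] _; congr (_ *: _).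
elim: (size e) h ie => [|n IHn] //= [h1 h2]; rewrite ltnS leq_eqVlt.
by case/predU1P => [->|/(IHn h2)].
Qed.

End LinearCombinations.

(** Vectors are compared up to conversion, because one vector can occur through
    different instance paths. *)
Ltac lcomb_index x e :=
  lazymatch e with
  | ?y :: ?e' =>
    match constr:(tt) with
    | _ => let _ := match constr:(tt) with _ => unify x y end in constr:(0%N)
    | _ => let i := lcomb_index x e' in constr:(S i)
    end
  end.

Ltac lcomb_add x e :=
  match constr:(tt) with
  | _ => let _ := lcomb_index x e in e
  | _ => constr:(x :: e)
  end.

Ltac lcomb_atoms t e :=
  lazymatch t with
  | @Algebra.zero _ => e
  | @Algebra.add _ ?a ?b => let e' := lcomb_atoms a e in lcomb_atoms b e'
  | @Algebra.opp _ ?a => lcomb_atoms a e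
  | @GRing.scale _ _ _ ?a => lcomb_atoms a e
  | _ => lcomb_add t e
  end.

Ltac lcomb_reify K t e :=
  lazymatch t with
  | @Algebra.zero _ => constr:(@LZero K)
  | @Algebra.add _ ?a ?b =>
    let a' := lcomb_reify K a e in let b' := lcomb_reify K b e in
    constr:(@LAdd K a' b')
  | @Algebra.opp _ ?a => let a' := lcomb_reify K a e in constr:(@LOpp K a')
  | @GRing.scale _ _ ?k ?a =>
    let a' := lcomb_reify K a e in constr:(@LScale K k a')
  | _ => let i := lcomb_index t e in constr:(@LVar K i)
  end.

(** [module_coefs K W] reduces an identity [u = v] in the [K]-module [W] to the
    identities between the coefficients of each vector that is not itself a sum,
    an opposite or a multiple; [module_eq K W] solves those that are ring
    identities. *)
Ltac module_coefs K W :=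
  lazymatch goal with
  | |- ?u = ?v =>
    let e0 := lcomb_atoms u (@nil W) in
    let e := lcomb_atoms v e0 in
    let t1 := lcomb_reify K u e in
    let t2 := lcomb_reify K v e in
    apply: (@lcomb_eq K W e t1 t2);
    cbn [size same_coefs lcomb_coef eqn]
  end.

Ltac module_eq K W := module_coefs K W; repeat split; ring.

(** * Insertion of multilinear maps *)

Section Insertion.
Variables (K : fieldType) (V : lmodType K).

(** Linearity in every slot, on lists of every length; unlike [multilinear] it
    does not fix the number of arguments. *)
Definition slot_linear (W : lmodType K) (F : seq V -> W) : Prop :=
  forall s1 s2 (a : K) (u v : V),
    F (s1 ++ (a *: u + v) :: s2) = a *: F (s1 ++ u :: s2) + F (s1 ++ v :: s2).

(** Signed sum of the insertions of [g], of degree [n] and so with [n.+1]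
    arguments, at all positions of the arguments of [F]. The recursion on the
    argument list makes it the transpose of the coderivation defined by [g].
    Near the end of the list [g] receives fewer than [n.+1] arguments, which is
    harmless when [g] vanishes on such lists. *)
Fixpoint insertion (W : lmodType K) (n : nat) (g : seq V -> V) (F : seq V -> W)
    (s : seq V) : W :=
  if s is x :: s' then
    F (g (take n.+1 s) :: drop n.+1 s)
      + (-1) ^+ n *: insertion n g (fun t => F (x :: t)) s'
  else 0.

Section SlotLinear.
Variables (W : lmodType K) (F : seq V -> W).
Hypothesis Flin : slot_linear F.

Lemma slot_linear0 s1 s2 : F (s1 ++ 0 :: s2) = 0.
Proof.
have /(congr1 (fun x => x - F (s1 ++ 0 :: s2))) := Flin s1 s2 1 0 0.
by rewrite scaler0 addr0 scale1r subrr addrK => <-.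
Qed.

Lemma slot_linearD s1 s2 u v :
  F (s1 ++ (u + v) :: s2) = F (s1 ++ u :: s2) + F (s1 ++ v :: s2).
Proof. by have := Flin s1 s2 1 u v; rewrite !scale1r. Qed.

Lemma slot_linearZ s1 s2 a u : F (s1 ++ (a *: u) :: s2) =
  a *: F (s1 ++ u :: s2).
Proof. by have := Flin s1 s2 a u 0; rewrite slot_linear0 !addr0. Qed.

Lemma slot_linear_cons x : slot_linear (fun t => F (x :: t)).
Proof. by move=> s1 s2 a u v; rewrite -!cat_cons Flin. Qed.

End SlotLinear.

Lemma multilinear_slot (W : lmodType K) n (F : seq V -> W) :
  multilinear n F -> slot_linear F.
Proof.
move=> [F0 FL] s1 s2 a u v.
have [sE|sE] := eqVneq (size s1 + (size s2).+1)%N n; first exact: FL.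
by rewrite !F0 ?scaler0 ?addr0 // size_cat.
Qed.

Lemma insertion_lin (W : lmodType K) n g (a : K) (F F' : seq V -> W) s :
  insertion n g (a *: F + F') s = a *: insertion n g F s + insertion n g F' s.
Proof.
elim: s F F' => [|x s IHs] F F' /=; first by rewrite scaler0 addr0.
rewrite (_ : (fun t => _) =
  a *: (fun t => F (x :: t)) + (fun t => F' (x :: t))) //.
by rewrite IHs !scalerDr !scalerA mulrC addrACA.
Qed.

Lemma insertion_slot_linear (W : lmodType K) n g (F : seq V -> W) :
  slot_linear g -> slot_linear F -> slot_linear (insertion n g F).
Proof.
move=> gl Fl s1 s2 a u v; elim: s1 F Fl => [|x s1 IHs] F Fl.
  rewrite /= (gl [::]) (Fl [::]) /=.
  rewrite (_ : (fun t => F (_ :: t)) =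
    a *: (fun t => F (u :: t)) + (fun t => F (v :: t))); last first.
    by apply/funext => t; exact: (Fl [::]).
  rewrite insertion_lin /=; module_eq K W.
rewrite !cat_cons /= IHs; last exact: slot_linear_cons.
set L := F _; set Ru := F _; set Rv := F _.
suff -> : L = a *: Ru + Rv by module_eq K W.
rewrite {}/L {}/Ru {}/Rv !take_cat !drop_cat; case: ltnP => ns /=.
  exact: (Fl (_ :: _)).
case: (n - size s1)%N => [|k] /=; first by rewrite cats0; exact: (Fl [:: _]).
rewrite (gl (x :: s1)); exact: (Fl [::]).
Qed.

Lemma insertion_short (W : lmodType K) n g (F : seq V -> W) s :
  (forall t, size t != n.+1 -> g t = 0) -> slot_linear F -> (size s <= n)%N ->
  insertion n g F s = 0.
Proof.
move=> g0; elim: s F => [|x s IHs] F Fl //= sn.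
rewrite IHs ?scaler0 ?addr0; [|exact: slot_linear_cons|exact: ltnW].
rewrite g0; first exact: (slot_linear0 Fl [::]).
by rewrite /= take_oversize 1?ltnW // neq_ltn ltnS sn.
Qed.

(** The offset [j] counts the arguments already absorbed by [F] in the
    recursion. *)
Lemma insertion_supp (W : lmodType K) m n g (F : seq V -> W) s :
  (forall t, size t != n.+1 -> g t = 0) -> slot_linear F ->
  forall j, (forall t, (size t + j)%N != m -> F t = 0) ->
  (size s + j)%N != (m + n)%N -> insertion n g F s = 0.
Proof.
move=> g0; elim: s F => [|x s IHs] F Fl //= j F0 sj.
rewrite (IHs _ _ j.+1) ?scaler0 ?addr0.
- have [ns|ns] := leqP n (size s).
    by apply: F0; rewrite /= size_drop; lia.
  rewrite g0; first exact: (slot_linear0 Fl [::]).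
  by rewrite /= size_take; case: ifP; lia.
- exact: slot_linear_cons.
- by move=> t tj; apply: F0; rewrite /= addSnnS.
by rewrite addnS -addSn.
Qed.

Lemma insertion_multilinear (W : lmodType K) m n g (F : seq V -> W) :
  multilinear n.+1 g -> multilinear m.+1 F ->
  multilinear (m + n).+1 (insertion n g F).
Proof.
move=> gm Fm; have [gl Fl] := (multilinear_slot gm, multilinear_slot Fm).
split=> [s ns|s1 s2 a u v _]; last exact: insertion_slot_linear.
apply: (@insertion_supp _ m.+1 n g F s gm.1 Fl 0).
  by move=> t; rewrite addn0 => /Fm.1.
by rewrite addn0 addSn.
Qed.

(** Inserting [h] into the arguments of [F (g (x_1, ..., x_k), x_(k+1), ...)]
    either inserts it into [g] or comes after [g]. *)
Lemma insertion_split (W : lmodType K) p h k (g : seq V -> V) (F : seq V -> W)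
  s :
  (forall t, size t != p.+1 -> h t = 0) -> slot_linear F -> slot_linear g ->
  insertion p h (fun t => F (g (take k t) :: drop k t)) s =
  F (insertion p h g (take (k + p) s) :: drop (k + p) s)
  + (-1) ^+ (k * p) *: insertion p h (fun t => F (g (take k s) :: t))
    (drop k s).
Proof.
move=> h0 Fl; elim: k g s => [|k IHk] g s gl.
  rewrite mul0n scale1r add0n drop0 take0.
  rewrite (insertion_short h0 gl) ?size_take_min ?geq_minl //.
  rewrite (slot_linear0 Fl [::]) add0r; congr (insertion _ _ _ s).
  by apply/funext => t; rewrite take0 drop0.
case: s => [|y s] /=; first by rewrite scaler0 addr0 (slot_linear0 Fl [::]).
rewrite (IHk (fun t => g (y :: t))); last exact: slot_linear_cons.
rewrite (slot_linearD Fl [::]) (slot_linearZ Fl [::]) /=.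
rewrite take_takel ?leq_addl // take_drop drop_drop.
rewrite mulSn exprD; module_eq K W.
Qed.

(** The graded commutator of two insertions is the insertion of the bracket,
    whence the Jacobi identity. *)
Lemma insertion_comm (W : lmodType K) n p g h (F : seq V -> W) s :
  multilinear n.+1 g -> multilinear p.+1 h -> slot_linear F ->
  insertion p h (insertion n g F) s - (-1) ^+ (n * p) *: insertion n g
    (insertion p h F) s =
  insertion (n + p) (insertion p h g - (-1) ^+ (n * p) *: insertion n g h) F s.
Proof.
move=> gm hm; have [gl hl] := (multilinear_slot gm, multilinear_slot hm).
elim: s F => [|x s IHs] F Fl; first by rewrite /= scaler0 subr0.
have insertionE q (k : seq V -> V) : (fun t => insertion q k F (x :: t)) =
    (-1) ^+ q *: insertion q k (fun t => F (x :: t))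
    + (fun t => F (k (x :: take q t) :: drop q t)).
  by apply/funext => t; rewrite /= addrC.
rewrite /= -(IHs (fun t => F (x :: t))); last exact: slot_linear_cons.
rewrite !insertionE !insertion_lin.
rewrite (insertion_split n s hm.1 Fl (slot_linear_cons gl x)).
rewrite (insertion_split p s gm.1 Fl (slot_linear_cons hl x)).
rewrite !fctE /= -!scaleNr !(slot_linearD Fl [::], slot_linearZ Fl [::]) /=.
have tE : drop n (take (n + p) s) =
  take p (drop n s) by rewrite take_drop addnC.
rewrite tE -take_drop !take_takel ?leq_addl ?leq_addr // !drop_drop.
rewrite (mulnC p n) (addnC p n) exprD.
have := sqrr_sign K n; have := sqrr_sign K p; have := sqrr_sign K (n * p).
move: ((-1) ^+ n) ((-1) ^+ p) ((-1) ^+ (n * p)) => en ep enp hnp hp hn.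
module_coefs K W; repeat split; ring: hnp hp hn.
Qed.

End Insertion.

(** * The Gerstenhaber bracket is a graded Lie bracket *)

Section Bracket.
Variables (K : fieldType) (V : lmodType K).
Implicit Types f g h : seq V -> V.

Lemma insertionE (W : lmodType K) n g (F : seq V -> W) s :
  insertion n g F s = \sum_(0 <= i < size s) (-1) ^+ (i * n) *:
    F (take i s ++ g (take n.+1 (drop i s)) :: drop (i + n.+1) s).
Proof.
elim: s F => [|x s IHs] F /=; first by rewrite big_nil.
rewrite big_nat_recl //= scale1r IHs scaler_sumr; congr (_ + _).
by apply: eq_bigr => i _; rewrite scalerA -exprD.
Qed.

Lemma gcirc_insertion m n f g :
  multilinear m.+1 f -> multilinear n.+1 g ->
    gcirc m.+1 n.+1 f g = insertion n g f.
Proof.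
move=> fm gm; apply/funext => s; rewrite /gcirc addSn /=.
case: eqP => [sE|/eqP sE]; last first.
  by rewrite (insertion_multilinear gm fm).1 // -addnS.
rewrite insertionE sE addnS; symmetry.
rewrite (big_cat_nat (n := m.+1)) ?ltnS ?leq_addr //=.
rewrite [X in _ + X](_ : _ = 0) ?addr0 // big_nat_cond;
  apply: big1 => i /andP[/andP[mi im] _].
rewrite gm.1; last by rewrite size_take size_drop; case: ifP; lia.
by rewrite (slot_linear0 (multilinear_slot fm)) scaler0.
Qed.

Lemma gbracket_insertion m n f g :
  multilinear m.+1 f -> multilinear n.+1 g ->
  gbracket f g = insertion n g f - (-1) ^+ (m * n) *: insertion m f g.
Proof.
move=> fm gm; rewrite (gbracket_homogeneous fm gm) // /gbracket_arity.
by rewrite !gcirc_insertion.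
Qed.

Lemma multilinear_lin n f g a :
  multilinear n f -> multilinear n g -> multilinear n (a *: f + g).
Proof.
move=> [f0 fl] [g0 gl]; split=> [s sn|s1 s2 b u v sE].
  by rewrite !fctE f0 // g0 // scaler0 addr0.
by rewrite !fctE fl // gl //; module_eq K V.
Qed.

Lemma multilinear0 n : multilinear n (0 : seq V -> V).
Proof. by split=> // s1 s2 a u v _; rewrite scaler0 addr0. Qed.

Lemma gbracket_multilinear m n f g :
  multilinear m.+1 f -> multilinear n.+1 g ->
    multilinear (m + n).+1 (gbracket f g).
Proof.
move=> fm gm; rewrite (gbracket_insertion fm gm) addrC -scaleNr.
apply: multilinear_lin; last exact: insertion_multilinear.
by rewrite addnC; exact: insertion_multilinear.
Qed.

Lemma gcirc_linl m n a f f' g :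
  gcirc m n (a *: f + f') g = a *: gcirc m n f g + gcirc m n f' g.
Proof.
apply/funext => s; rewrite !fctE /gcirc; case: ifP;
  last by rewrite scaler0 addr0.
move=> _; rewrite scaler_sumr -big_split; apply: eq_bigr => i _ /=.
by module_eq K V.
Qed.

Lemma gcirc_linr m n a f g g' :
  slot_linear f -> gcirc m n f (a *: g + g') =
    a *: gcirc m n f g + gcirc m n f g'.
Proof.
move=> fl; apply/funext => s; rewrite !fctE /gcirc.
case: ifP; last by rewrite scaler0 addr0.
move=> _; rewrite scaler_sumr -big_split; apply: eq_bigr => i _ /=.
by rewrite fl; module_eq K V.
Qed.

Lemma gbracket_linl a f f' g :
  slot_linear g -> gbracket (a *: f + f') g = a *: gbracket f g + gbracket f' g.
Proof.
move=> gl; apply/funext => s; rewrite !fctE /gbracket scaler_sumr -big_split.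
apply: eq_bigr => i _; rewrite /gbracket_arity gcirc_linl
  (gcirc_linr _ _ _ _ _ gl).
by rewrite /= !fctE; module_eq K V.
Qed.

Lemma gbracket_linr a f g g' :
  slot_linear f -> gbracket f (a *: g + g') = a *: gbracket f g + gbracket f g'.
Proof.
move=> fl; apply/funext => s; rewrite !fctE /gbracket scaler_sumr -big_split.
apply: eq_bigr => i _; rewrite /gbracket_arity gcirc_linl
  (gcirc_linr _ _ _ _ _ fl).
by rewrite /= !fctE; module_eq K V.
Qed.

Lemma gbracket0l g : slot_linear g -> gbracket 0 g = 0.
Proof.
move=> gl; have := gbracket_linl (-1) 0 0 gl.
by rewrite scaler0 addr0 scaleN1r addNr.
Qed.

Lemma gbracketDl f f' g :
  slot_linear g -> gbracket (f + f') g = gbracket f g + gbracket f' g.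
Proof. by move=> gl; have := gbracket_linl 1 f f' gl; rewrite !scale1r. Qed.

Lemma gbracketZl a f g : slot_linear g ->
  gbracket (a *: f) g = a *: gbracket f g.
Proof. by move=> gl; have := gbracket_linl a f 0 gl;
  rewrite gbracket0l // !addr0. Qed.

Lemma gbracket0r f : slot_linear f -> gbracket f 0 = 0.
Proof.
move=> fl; have := gbracket_linr (-1) 0 0 fl.
by rewrite scaler0 addr0 scaleN1r addNr.
Qed.

(** Homogeneous elements whose degree has parity [e]. Every sign depends on
    degrees through their parities only, and 0 has both parities. *)
Definition parity_elt (e : bool) f := exists2 n, odd n = e & multilinear n.+1 f.

(** The sign of a parity. *)
Definition parity_sign (b : bool) : K := (-1) ^+ b.

Lemma parity_signM m n : (-1) ^+ (m * n) = parity_sign (odd m && odd n).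
Proof. by rewrite /parity_sign -signr_odd oddM. Qed.

Lemma parity_signD a b : parity_sign (a (+) b) = parity_sign a * parity_sign b.
Proof. exact: signr_addb. Qed.

Lemma parity_sign_sq a : parity_sign a ^+ 2 = 1.
Proof. exact: sqrr_sign. Qed.

Lemma parity_slot e f : parity_elt e f -> slot_linear f.
Proof. by case=> n _ /multilinear_slot. Qed.

Lemma parity_elt0 e : parity_elt e 0.
Proof. by exists (nat_of_bool e); [case: e|exact: multilinear0]. Qed.

Lemma parity_gbracket e1 e2 f g :
  parity_elt e1 f -> parity_elt e2 g -> parity_elt (e1 (+) e2) (gbracket f g).
Proof.
move=> [m <- fm] [n <- gm]; exists (m + n)%N; first by rewrite oddD.
exact: gbracket_multilinear.
Qed.

Lemma gbracketC e1 e2 f g : parity_elt e1 f -> parity_elt e2 g ->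
  gbracket f g = - parity_sign (e1 && e2) *: gbracket g f.
Proof.
move=> [m <- fm] [n <- gm];
  rewrite !(gbracket_insertion fm gm, gbracket_insertion gm fm).
rewrite (mulnC n m) parity_signM; have := parity_sign_sq (odd m && odd n).
move: (parity_sign _) => c hc; module_coefs K (seq V -> V); repeat split;
  ring: hc.
Qed.

Lemma gbracket_jacobi e1 e2 e3 f g h :
  parity_elt e1 f -> parity_elt e2 g -> parity_elt e3 h ->
  gbracket (gbracket f g) h =
  gbracket f (gbracket g h) + parity_sign (e2 && e3) *: gbracket (gbracket f h)
    g.
Proof.
move=> [m _ fm] [n <- gm] [p <- hm].
have [fl gl hl] : [/\ slot_linear f, slot_linear g & slot_linear h].
  by split; [exact: multilinear_slot fm|exact: multilinear_slot gm|exact: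
    multilinear_slot hm].
rewrite (gbracket_insertion (gbracket_multilinear fm gm) hm).
rewrite (gbracket_insertion fm (gbracket_multilinear gm hm)).
rewrite (gbracket_insertion (gbracket_multilinear fm hm) gm).
rewrite (gbracket_insertion fm gm) (gbracket_insertion gm hm)
  (gbracket_insertion fm hm).
have ic q r k l F : multilinear q.+1 k -> multilinear r.+1 l -> slot_linear F ->
    insertion (q + r) (insertion r l k - (-1) ^+ (q * r) *: insertion q k l) F =
    insertion r l (insertion q k F) - (-1) ^+ (q * r) *: insertion q k
      (insertion r l F).
  by move=> km lm Fl; apply/funext => s; rewrite -insertion_comm.
have cE q k F F' (a : K) :
    insertion q k (F - a *: F') =
      insertion q k F - a *: insertion q k F' :> (seq V -> V).
  by apply/funext => s; rewrite addrC -scaleNr insertion_lin !fctE;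
    module_eq K V.
rewrite !ic // !cE -parity_signM !mulnDl !mulnDr !exprD (mulnC p n).
have := sqrr_sign K (m * n); have := sqrr_sign K (m * p).
have := sqrr_sign K (n * p).
move: ((-1) ^+ (m * n)) ((-1) ^+ (m * p)) ((-1) ^+ (n * p)) => a b c hc hb ha.
module_coefs K (seq V -> V); repeat split; ring: ha hb hc.
Qed.
End Bracket.

(** * Unshuffles and derived brackets *)

Section Unshuffle.
Variables (K : fieldType) (X E : lmodType K).
Implicit Types (z : bool * X) (zs I J : seq (bool * X)).
Implicit Types F G : seq (bool * X) -> seq (bool * X) -> E.

(** Elements are paired with their parities. *)
Definition total_parity zs : bool := foldr (fun z b => z.1 (+) b) false zs.

(** Sum of [F I J] over the ways of distributing [zs] over two subsequences [I]
    and [J], with the Koszul sign of [zs |-> I ++ J]: putting the head of [zs]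
    in [J] moves it past all of [I]. *)
Fixpoint unshuffle F zs : E :=
  if zs is z :: zs' then
    unshuffle (fun I J => F (z :: I) J) zs'
    + unshuffle (fun I J => parity_sign K (z.1 && total_parity I) *: F I
      (z :: J)) zs'
  else F [::] [::].

Lemma eq_unshuffle F G zs :
  (forall I J, {subset I <= zs} -> {subset J <= zs} ->
     (size I + size J)%N = size zs -> F I J = G I J) ->
  unshuffle F zs = unshuffle G zs.
Proof.
elim: zs F G => [|z zs IHzs] F G FG /=; first exact: FG.
have sub I : {subset I <= zs} -> {subset I <= z :: zs}.
  by move=> s x /s; rewrite inE orbC => ->.
have subc I : {subset I <= zs} -> {subset z :: I <= z :: zs}.
  by move=> s x; rewrite !inE => /orP[->//|/s->]; rewrite orbT.
congr (_ + _); apply: IHzs => I J sI sJ IJ.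
  by rewrite FG ?addSn ?IJ //; [exact: subc|exact: sub].
by rewrite FG ?addnS ?IJ //; [exact: sub|exact: subc].
Qed.

Lemma unshuffle_lin a F G zs :
  unshuffle (fun I J => a *: F I J + G I J) zs
  = a *: unshuffle F zs + unshuffle G zs.
Proof.
elim: zs F G => [//|z zs IHzs] F G /=; rewrite IHzs.
rewrite (_ : (fun I J => _ *: (_ + _)) = (fun I J =>
  a *: (parity_sign K (z.1 && total_parity I) *: F I (z :: J))
  + parity_sign K (z.1 && total_parity I) *: G I (z :: J))).
  by rewrite IHzs; module_eq K E.
by apply/funext => I; apply/funext => J; module_eq K E.
Qed.

Lemma unshuffle0 zs : unshuffle (fun _ _ => 0) zs = 0.
Proof.
have := unshuffle_lin (-1) (fun _ _ => 0) (fun _ _ => 0) zs.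
by rewrite scaler0 addr0 scaleN1r addNr.
Qed.

Lemma unshuffleZ a F zs :
  unshuffle (fun I J => a *: F I J) zs = a *: unshuffle F zs.
Proof.
have := unshuffle_lin a F (fun _ _ => 0) zs.
rewrite unshuffle0 addr0 => <-; apply: eq_unshuffle => I J _ _ _.
by rewrite addr0.
Qed.

Lemma unshuffle_sum n (F : nat -> seq (bool * X) -> seq (bool * X) -> E) zs :
  unshuffle (fun I J => \sum_(i < n) F i I J) zs =
    \sum_(i < n) unshuffle (F i) zs.
Proof.
elim: n => [|n IHn].
  rewrite big_ord0 -[RHS](unshuffle0 zs); apply: eq_unshuffle => I J _ _ _.
  by rewrite big_ord0.
rewrite big_ord_recr /= -IHn addrC -[unshuffle (F n) zs]scale1r -unshuffle_lin.
by apply: eq_unshuffle => I J _ _ _; rewrite big_ord_recr scale1r addrC.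
Qed.

Lemma unshuffle_swap F zs :
  unshuffle F zs =
  unshuffle (fun I J => parity_sign K (total_parity I && total_parity J) *: F J
    I) zs.
Proof.
elim: zs F => [|z zs IHzs] F /=; first by rewrite scale1r.
rewrite addrC IHzs [X in _ + X]IHzs; congr (_ + _).
  apply: eq_unshuffle => I J _ _ _; rewrite scalerA -parity_signD;
    congr (parity_sign _ _ *: _).
  by case: z.1 (total_parity I) (total_parity J) => -[] [].
apply: eq_unshuffle => I J _ _ _; rewrite scalerA -parity_signD;
  congr (parity_sign _ _ *: _).
by case: z.1 (total_parity I) (total_parity J) => -[] [].
Qed.

End Unshuffle.

(** Derived brackets of a sequence [D] of odd elements with respect to an
    abelian subspace [abel], under the assumptions that [D k] nested with [k]
    elements of [abel] is in [abel] and vanishes when nested with more of them,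
    and that the sum of the [D p, D q] over p + q = N is 0. *)
Section Derived.
Variables (K : fieldType) (V : lmodType K).
Let E := seq V -> V.
Variables (D : nat -> E) (abel : E -> Prop).
Hypothesis two_neq0 : 2%:R != 0 :> K.
Hypothesis D_odd : forall k, parity_elt true (D k).
Hypothesis D_sq : forall N, \sum_(p < N.+1) gbracket (D p) (D (N - p)%N) = 0.
Hypothesis abelC : forall f g, abel f -> abel g -> gbracket f g = 0.

Implicit Types (z : bool * E) (zs I J : seq (bool * E)).

(** The iterated bracket [[...[f, z_1], ..., z_k]]. *)
Definition nested f zs : E := foldl (fun f z => gbracket f z.2) f zs.

(** A parity with an element of [abel] of that parity. *)
Definition admissible z := parity_elt z.1 z.2 /\ abel z.2.

Hypothesis nested_abel : forall zs, {in zs, forall z, admissible z} ->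
  abel (nested (D (size zs)) zs).
Hypothesis nested_gt : forall zs k, {in zs, forall z, admissible z} ->
  (k < size zs)%N -> nested (D k) zs = 0.

Lemma admissible_cons z zs : {in z :: zs, forall z, admissible z} ->
  admissible z /\ {in zs, forall z, admissible z}.
Proof.
by move=> h; split=> [|y yzs]; apply: h; rewrite inE ?eqxx // yzs orbT.
Qed.

Lemma nested_lin a f f' zs : {in zs, forall z, admissible z} ->
  nested (a *: f + f') zs = a *: nested f zs + nested f' zs.
Proof.
elim: zs f f' => [//|z zs IHzs] f f' /admissible_cons[[zp _] zsg] /=.
by rewrite gbracket_linl ?IHzs //; exact: parity_slot zp.
Qed.

Lemma nested0 zs : {in zs, forall z, admissible z} -> nested 0 zs = 0.
Proof.
move=> zsg; have := nested_lin (-1) 0 0 zsg.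
by rewrite scaler0 addr0 scaleN1r addNr.
Qed.

Lemma nestedZ a f zs : {in zs, forall z, admissible z} ->
  nested (a *: f) zs = a *: nested f zs.
Proof. by move=> zsg; rewrite -[a *: f]addr0 nested_lin // nested0 ?addr0. Qed.

Lemma nested_sum n (f : 'I_n -> E) zs : {in zs, forall z, admissible z} ->
  nested (\sum_i f i) zs = \sum_i nested (f i) zs.
Proof.
move=> zsg; elim/big_rec2: _ => [|i y x _ <-]; first exact: nested0.
by rewrite -[f i]scale1r nested_lin // !scale1r.
Qed.

Lemma nested_parity e f zs : parity_elt e f ->
  {in zs, forall z, admissible z} ->
  parity_elt (e (+) total_parity zs) (nested f zs).
Proof.
elim: zs e f => [|z zs IHzs] e f fe /=; first by rewrite addbF.
move=> /admissible_cons[[zp _] zsg]; rewrite addbA; apply: IHzs => //.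
exact: parity_gbracket.
Qed.

Lemma nested_swap e f z zs :
  parity_elt e f -> admissible z -> {in zs, forall z, admissible z} ->
  gbracket (nested f zs) z.2 =
  parity_sign K (z.1 && total_parity zs) *: nested (gbracket f z.2) zs.
Proof.
move=> + [zp za]; elim: zs e f => [|y zs IHzs] e f fe.
  by rewrite /= andbF scale1r.
move=> /admissible_cons[[yp ya] zsg] /=;
  rewrite (IHzs _ _ (parity_gbracket fe yp) zsg).
rewrite (gbracket_jacobi fe yp zp) (abelC ya za) gbracket0r ?add0r; last first.
  exact: parity_slot fe.
rewrite nestedZ // scalerA -parity_signD; congr (parity_sign _ _ *: _).
by case: z.1 y.1 (total_parity zs) => -[] [].
Qed.

(** Iterated brackets distribute over a bracket; [Y] has to be moved past the
    elements that go to the first factor. *)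
Lemma nested_leibniz eX eY X Y zs :
  parity_elt eX X -> parity_elt eY Y -> {in zs, forall z, admissible z} ->
  nested (gbracket X Y) zs =
  unshuffle (fun I J => parity_sign K (eY && total_parity I) *:
                        gbracket (nested X I) (nested Y J)) zs.
Proof.
elim: zs eX eY X Y => [|z zs IHzs] eX eY X Y Xp Yp.
  by rewrite /= andbF scale1r.
move=> /admissible_cons[[zp za] zsg] /=.
rewrite (gbracket_jacobi Xp Yp zp) addrC nested_lin //.
rewrite (IHzs _ _ _ _ (parity_gbracket Xp zp) Yp zsg).
rewrite (IHzs _ _ _ _ Xp (parity_gbracket Yp zp) zsg).
rewrite -unshuffleZ; congr (_ + _); apply: eq_unshuffle => I J _ _ _.
  rewrite scalerA -parity_signD; congr (parity_sign _ _ *: _).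
  by case: eY z.1 (total_parity I) {Yp} => -[] [].
rewrite scalerA -parity_signD; congr (parity_sign _ _ *: _).
by case: eY z.1 (total_parity I) {Yp} => -[] [].
Qed.

(** The derived bracket of a list of elements. *)
Definition derived_op zs := nested (D (size zs)) zs.

Lemma derived_op_admissible zs : {in zs, forall z, admissible z} ->
  admissible (~~ total_parity zs, derived_op zs).
Proof.
move=> zsg; split; last exact: nested_abel.
exact: (nested_parity (D_odd _) zsg).
Qed.

Lemma derived_jacobi zs : {in zs, forall z, admissible z} ->
  unshuffle (fun I J => derived_op ((~~ total_parity I, derived_op I) :: J)) zs
    = 0.
Proof.
move=> zsg; set F := (fun I J => derived_op _).
(* The two ways of saturating a factor of [D p, D q] give the same sum. *)
suff : 2%:R *: unshuffle F zs = 0.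
  by move/eqP; rewrite scaler_eq0 (negPf two_neq0) => /eqP.
transitivity (nested (\sum_(p < (size zs).+2)
    gbracket (D p) (D ((size zs).+1 - p)%N)) zs); last first.
  by rewrite D_sq nested0.
rewrite nested_sum //.
pose G p I J := parity_sign K (true && total_parity I) *:
  gbracket (nested (D p) I) (nested (D ((size zs).+1 - p)%N) J).
transitivity (\sum_(p < (size zs).+2) unshuffle (G p) zs); last first.
  by apply: eq_bigr => p _; rewrite (nested_leibniz (D_odd _) (D_odd _) zsg).
rewrite -unshuffle_sum scaler_nat mulr2n /G.
rewrite [X in _ + X]unshuffle_swap -[X in X + _]scale1r -unshuffle_lin.
apply: eq_unshuffle => I J sI sJ IJ; rewrite scale1r.
have Ig : {in I, forall z, admissible z} by move=> z /sI/zsg.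
have Jg : {in J, forall z, admissible z} by move=> z /sJ/zsg.
have iP : (size I < (size zs).+2)%N by rewrite -IJ; lia.
have i1P : ((size I).+1 < (size zs).+2)%N by rewrite -IJ; lia.
(* With i elements in I and j in J, p + q = i + j + 1: the terms with p < i or q
   < j vanish, which leaves p = i and p = i + 1. *)
rewrite (bigD1 (Ordinal iP)) //= (bigD1 (Ordinal i1P)) /=; last first.
  by rewrite -val_eqE /= neq_ltn ltnSn orbT.
rewrite [X in _ + (_ + X)](_ : _ = 0) ?addr0; last first.
  apply: big1 => p; rewrite -!val_eqE /= => /andP[pi pi1].
  have [pI|pI] := ltnP p (size I).
    rewrite (nested_gt Ig pI) gbracket0l ?scaler0 //.
    exact: parity_slot (nested_parity (D_odd _) Jg).
  rewrite (nested_gt Jg) ?gbracket0r ?scaler0 //; last first.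
    by have := ltn_ord p; move: (nat_of_ord p) pI pi pi1; rewrite -IJ;
      move: (size I) (size J); lia.
  exact: parity_slot (nested_parity (D_odd _) Ig).
have -> : ((size zs).+1 - size I)%N = (size J).+1 by rewrite -IJ; lia.
have -> : ((size zs).+1 - (size I).+1)%N = size J by rewrite -IJ; lia.
congr (_ + _).
  rewrite (gbracketC (derived_op_admissible Ig).1 (nested_parity (D_odd _) Jg)).
  rewrite (nested_swap (D_odd _) (derived_op_admissible Ig) Jg) !scalerA /F /=.
  rewrite -[LHS]scale1r; congr (_ *: _); rewrite /parity_sign.
  by case: (total_parity I) (total_parity J) => -[];
     rewrite /= ?expr0 ?expr1 ?mulNr ?mulrN ?mulr1 ?opprK.
rewrite (nested_swap (D_odd _) (derived_op_admissible Jg) Ig) !scalerA /F /=.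
congr (_ *: _); rewrite -parity_signD; congr parity_sign.
by case: (total_parity I) (total_parity J) => -[].
Qed.

End Derived.

(** * Koszul signs and shuffles *)

Section KoszulList.
Variables (K : fieldType) (N : nat) (e : 'I_N -> bool).
Implicit Types (k : 'I_N) (ks I J L : seq 'I_N).

(** The strict order of the indices. *)
Definition lt_ord : rel 'I_N := fun i j => (i < j)%N.

Lemma lt_ord_trans : transitive lt_ord.
Proof. by move=> j i k; exact: ltn_trans. Qed.

Lemma lt_ord_irr : irreflexive lt_ord.
Proof. by move=> i; exact: ltnn. Qed.

Lemma enum_lt_ord_sorted : sorted lt_ord (enum 'I_N).
Proof. by have := @sorted_map _ _ (val : 'I_N -> nat) ltn (enum 'I_N);
  rewrite val_enum_ord iota_ltn_sorted => <-. Qed.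

(** Sign of the inversions between a block [I] and a later block [J]. *)
Definition cross I J : K := \prod_(i <- I) \prod_(j <- J | lt_ord j i)
  parity_sign K (e i && e j).

(** Koszul sign of rearranging indices from increasing order into the order of
    the list. *)
Fixpoint koszul_seq ks : K :=
  if ks is k :: ks' then cross [:: k] ks' * koszul_seq ks' else 1.

Definition parity_seq ks : bool := foldr (fun k b => e k (+) b) false ks.

Lemma cross_consl k I J : cross (k :: I) J = cross [:: k] J * cross I J.
Proof. by rewrite /cross big_cons big_seq1. Qed.

Lemma cross_catr I J J' : cross I (J ++ J') = cross I J * cross I J'.
Proof. by rewrite /cross -big_split; apply: eq_bigr => i _;
  rewrite big_cat. Qed.

Lemma koszul_seq_cat I J :
  koszul_seq (I ++ J) = koszul_seq I * cross I J * koszul_seq J.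
Proof.
elim: I => [|k I IHI] /=; first by rewrite /cross big_nil !mul1r.
by rewrite IHI (cross_consl k I) cross_catr; ring.
Qed.

Lemma cross_sq I J : cross I J ^+ 2 = 1.
Proof.
rewrite /cross -prodrXl big1 // => i _; rewrite -prodrXl big1 // => j _.
exact: parity_sign_sq.
Qed.

Lemma cross_swap I J : uniq (I ++ J) ->
  cross I J * cross J I = parity_sign K (parity_seq I && parity_seq J).
Proof.
have sg_par b L : \prod_(j <- L) parity_sign K (b && e j) =
  parity_sign K (b && parity_seq L).
  elim: L => [|j L IHL] /=; first by rewrite big_nil andbF.
  by rewrite big_cons IHL -parity_signD; congr parity_sign;
    case: b {IHL} (e j) (parity_seq L) => -[] [].
rewrite cat_uniq => /and3P[_ /hasPn IJ _].
transitivity (\prod_(i <- I) \prod_(j <- J) parity_sign K (e i && e j)).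
  rewrite /cross [X in _ * X](exchange_big_dep xpredT) //= -big_split.
  rewrite big_seq [RHS]big_seq; apply: eq_bigr => i iI.
  rewrite [RHS](bigID (fun j => lt_ord j i)) /=; congr (_ * _).
  rewrite big_seq_cond [RHS]big_seq_cond.
  apply: eq_big => [j|j _]; last by rewrite andbC.
  case jJ: (j \in J) => //=; rewrite /lt_ord -leqNgt ltn_neqAle.
  case: eqP => //= /val_inj ij.
  by have := IJ _ jJ; rewrite /= -ij iI.
elim: I {IJ} => [|i I IHI] /=; first by rewrite big_nil.
rewrite big_cons IHI sg_par -parity_signD; congr parity_sign.
by case: (e i) (parity_seq I) (parity_seq J) => -[] [].
Qed.

Lemma koszul_seq_sorted ks : sorted lt_ord ks -> koszul_seq ks = 1.
Proof.
elim: ks => [//|k ks IHks] /= pk; rewrite IHks ?(path_sorted pk) // mulr1.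
rewrite /cross big_seq1 big_seq_cond big1 // => j /andP[jk jlt].
have := allP (order_path_min lt_ord_trans pk) _ jk.
by rewrite /lt_ord => /ltn_trans/(_ jlt); rewrite ltnn.
Qed.

Lemma koszul_seqE (d : 'I_N -> int) (s : 'S_N) :
  (forall i, e i = odd `|d i|%N) ->
    koszul K d s = koszul_seq (map s (enum 'I_N)).
Proof.
move=> ed.
have sgz (a b : int) : (-1) ^ (a * b) =
  parity_sign K (odd `|a|%N && odd `|b|%N).
  rewrite -parity_signM -abszM; case: (a * b) => n //.
  by rewrite NegzE -exprz_inv invrN1.
have pE ks : sorted lt_ord ks ->
    \prod_(i <- ks) \prod_(j <- ks | (i < j)%N && (s j < s i)%N) parity_sign K
      (e (s i) && e (s j))
    = koszul_seq (map s ks).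
  elim: ks => [|k ks IHks] /= pk; first by rewrite big_nil.
  have /allP kmin := order_path_min lt_ord_trans pk.
  rewrite big_cons -IHks ?(path_sorted pk) //; congr (_ * _).
    rewrite big_cons ltnn /= /cross big_seq1 big_map.
    rewrite big_seq_cond [RHS]big_seq_cond; apply: eq_bigl => j.
    by case jk: (j \in ks) => //=; have := kmin _ jk; rewrite /lt_ord => ->.
  rewrite big_seq [RHS]big_seq; apply: eq_bigr => i /kmin ki.
  by rewrite big_cons ltnNge (ltnW ki).
rewrite -pE ?enum_lt_ord_sorted //.
rewrite /koszul big_enum /=; apply: eq_bigr => i _.
rewrite [RHS]big_enum_cond /=; apply: eq_bigr => j _.
by rewrite sgz !ed.
Qed.

End KoszulList.

Section Splits.
Variable (N : nat).
Implicit Types (k : 'I_N) (ks I J L : seq 'I_N).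
Local Notation lt_ord := (@lt_ord N).

(** The ways of distributing [ks] over two subsequences. *)
Fixpoint splits ks : seq (seq 'I_N * seq 'I_N) :=
  if ks is k :: ks' then
    [seq (k :: p.1, p.2) | p <- splits ks'] ++
      [seq (p.1, k :: p.2) | p <- splits ks']
  else [:: ([::], [::])].

Lemma mem_splits ks I J : sorted lt_ord ks ->
  ((I, J) \in splits ks) = [&& sorted lt_ord I,
    sorted lt_ord J & perm_eq (I ++ J) ks].
Proof.
elim: ks I J => [|k ks IHks] I J.
  rewrite inE => _; apply/eqP/and3P => [[-> ->] //|[_ _ /perm_size/eqP]].
  by rewrite size_cat addn_eq0 => /andP[/nilP-> /nilP->].
move=> /= pk; have ks_sorted := path_sorted pk.
have kmin := order_path_min (@lt_ord_trans N) pk.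
have path_sub L : {subset L <= ks} -> path lt_ord k L = sorted lt_ord L.
  move=> Lks; rewrite path_sortedE; last exact: lt_ord_trans.
  suff -> : all (lt_ord k) L by [].
  by apply/allP => j /Lks /(allP kmin).
rewrite mem_cat; apply/orP/and3P => [|[sI sJ pIJ]].
  case=> /mapP[[I' J'] + [-> ->]] /=; rewrite IHks // => /and3P[sI sJ pIJ].
    split=> //; last by rewrite perm_cons.
    by rewrite path_sub // => i iI; rewrite -(perm_mem pIJ) mem_cat iI.
  split=> //; last by rewrite perm_catC /= perm_cons perm_catC.
  by rewrite path_sub // => i iI; rewrite -(perm_mem pIJ) mem_cat iI orbT.
have hd L : sorted lt_ord L -> {subset L <= k :: ks} -> k \in L ->
  exists L', L = k :: L'.
  case: L => [//|h L] /= ph sub; rewrite inE => /orP[/eqP->|kL];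
    first by exists L.
  have hk := allP (order_path_min (@lt_ord_trans N) ph) _ kL.
  have := sub h; rewrite !inE eqxx => /(_ isT)/orP[/eqP hE|/(allP kmin) kh].
    by rewrite hE lt_ord_irr in hk.
  by have := lt_ord_trans hk kh; rewrite lt_ord_irr.
have : k \in I ++ J by rewrite (perm_mem pIJ) inE eqxx.
have subI : {subset I <= k :: ks} by move=> i iI;
  rewrite -(perm_mem pIJ) mem_cat iI.
have subJ : {subset J <= k :: ks}.
  by move=> i iI; rewrite -(perm_mem pIJ) mem_cat iI orbT.
rewrite mem_cat => /orP[/(hd _ sI subI)|/(hd _ sJ subJ)] [L LE]; [left|right].
  apply/mapP; exists (L, J); rewrite ?LE // IHks // sJ /=.
  by move: sI pIJ; rewrite LE /= perm_cons => /path_sorted -> ->.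
apply/mapP; exists (I, L); rewrite ?LE // IHks // sI /=.
by move: sJ pIJ; rewrite LE /= perm_catC /= perm_cons perm_catC => /path_sorted
  -> ->.
Qed.

Lemma splits_uniq ks : sorted lt_ord ks -> uniq (splits ks).
Proof.
elim: ks => [//|k ks IHks] /= pk; have ks_sorted := path_sorted pk.
rewrite cat_uniq !map_inj_uniq ?IHks //; last 2 first.
- by move=> [I J] [I' J'] [-> ->].
- by move=> [I J] [I' J'] [-> ->].
rewrite andbT /=; apply/hasPn => _ /mapP[[I J] IJ ->]; apply/negP.
case/mapP => -[I' J'] _ /= [IE _].
move: IJ; rewrite mem_splits // => /and3P[_ _ pIJ].
have kks : k \in ks by rewrite -(perm_mem pIJ) IE mem_cat inE eqxx.
have := allP (order_path_min (@lt_ord_trans N) pk) _ kks.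
by rewrite lt_ord_irr.
Qed.

End Splits.

Lemma unshuffle_splits (K : fieldType) (X E : lmodType K) N (e : 'I_N -> bool)
    (x : 'I_N -> X) (F : seq (bool * X) -> seq (bool * X) -> E) ks :
  sorted (@lt_ord N) ks ->
  let z := map (fun k => (e k, x k)) in
  unshuffle F (z ks) = \sum_(p <- splits ks) cross K e p.1 p.2 *: F (z p.1)
    (z p.2).
Proof.
move=> + z; elim: ks F => [|k ks IHks] F;
  first by rewrite /= big_seq1 /cross big_nil scale1r.
move=> /= pk; have ks_sorted := path_sorted pk.
have kmin := order_path_min (@lt_ord_trans N) pk.
rewrite !IHks // big_cat !big_map /=; congr (_ + _).
  rewrite big_seq [RHS]big_seq; apply: eq_bigr => -[I J].
  rewrite mem_splits //= => /and3P[_ _ pIJ]; rewrite cross_consl.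
  rewrite [cross K e [:: k] J]big_seq1 big_seq_cond big1 ?mul1r // =>
    j /andP[jJ jk].
  have : j \in ks by rewrite -(perm_mem pIJ) mem_cat jJ orbT.
  by move=> /(allP kmin) /(lt_ord_trans jk); rewrite lt_ord_irr.
rewrite big_seq [RHS]big_seq; apply: eq_bigr => -[I J].
rewrite mem_splits //= => /and3P[_ _ pIJ]; rewrite scalerA; congr (_ *: _).
have Iks : {subset I <= ks} by move=> i iI; rewrite -(perm_mem pIJ) mem_cat iI.
elim: I Iks {pIJ} => [|i I IHI] Iks /=.
  by rewrite /cross !big_nil andbF mulr1.
rewrite [LHS](_ : _ = cross K e [:: i] J * parity_sign K (e k && e i) *
  (cross K e I J * parity_sign K (e k && total_parity (z I)))); last first.
  rewrite cross_consl; have ->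
    : parity_sign K (e k && (e i (+) total_parity (z I))) =
    parity_sign K (e k && e i) * parity_sign K (e k && total_parity (z I)).
    by rewrite -parity_signD; congr parity_sign;
      case: (e k) (e i) (total_parity _) => -[] [].
  by ring.
rewrite IHI; last by move=> j jI; rewrite Iks // inE jI orbT.
rewrite [RHS]cross_consl; congr (_ * _).
rewrite /cross !big_seq1 big_cons.
have -> : lt_ord k i by apply: (allP kmin); rewrite Iks // inE eqxx.
by rewrite andbC mulrC.
Qed.

Section Shuffles.
Variable (n : nat).
Local Notation N := n.+1.
Local Notation lt_ord := (@lt_ord N).

(** A permutation as the list of its values. *)
Definition perm_seq (s : 'S_N) : seq 'I_N := map s (enum 'I_N).

Lemma size_perm_seq s : size (perm_seq s) = N.
Proof. by rewrite size_map size_enum_ord. Qed.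

Lemma nth_perm_seq s (i : 'I_N) : nth ord0 (perm_seq s) i = s i.
Proof. by rewrite (nth_map ord0) ?size_enum_ord // nth_ord_enum. Qed.

Lemma perm_seq_inj : injective perm_seq.
Proof. by move=> s t st; apply/permP => i; rewrite -!nth_perm_seq st. Qed.

Lemma perm_seq_perm s : perm_eq (perm_seq s) (enum 'I_N).
Proof.
apply: uniq_perm; rewrite ?(map_inj_uniq perm_inj) ?enum_uniq //.
move=> i; rewrite mem_enum; apply/mapP; exists ((s^-1)%g i);
  first by rewrite mem_enum.
by rewrite permKV.
Qed.

Lemma perm_seq_surj L : perm_eq L (enum 'I_N) -> exists s, perm_seq s = L.
Proof.
move=> pL; have Lu : uniq L by rewrite (perm_uniq pL) enum_uniq.
have sL : size L = N by rewrite (perm_size pL) size_enum_ord.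
have inj : injective (fun i : 'I_N => nth ord0 L i).
  by move=> i j /eqP; rewrite nth_uniq ?sL // => /eqP/val_inj.
exists (perm inj); apply: (@eq_from_nth _ ord0);
  rewrite size_perm_seq ?sL // => i iN.
by rewrite -[i]/(val (Ordinal iN)) nth_perm_seq permE.
Qed.

Lemma shuffleE i s : shuffle i s =
  sorted lt_ord (take i (perm_seq s)) && sorted lt_ord (drop i (perm_seq s)).
Proof.
have tr := @lt_ord_trans N.
rewrite !sorted_pairwise //.
apply/forallP/andP => [h|[/(pairwiseP ord0) h1 /(pairwiseP ord0) h2] a].
  split; apply/(pairwiseP ord0) => a b.
    rewrite !inE !size_take_min size_perm_seq !leq_min
      => /andP[ai aN] /andP[bi bN] ab.
    rewrite !nth_take // -[a]/(val (Ordinal aN)) -[b]/(val (Ordinal bN))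
      !nth_perm_seq.
    by have /forallP/(_ (Ordinal bN))/implyP := h (Ordinal aN); apply;
      rewrite /= ab bi.
  rewrite !inE !size_drop size_perm_seq => ai bi ab.
  have aN : (i + a < N)%N by lia.
  have bN : (i + b < N)%N by lia.
  rewrite !nth_drop -[(i + a)%N]/(val (Ordinal aN))
    -[(i + b)%N]/(val (Ordinal bN)).
  rewrite !nth_perm_seq; have /forallP/(_ (Ordinal bN))/implyP := h
    (Ordinal aN).
  by apply; rewrite /= ltn_add2l ab leq_addr orbT.
apply/forallP => b; apply/implyP => /andP[ab /orP[bi|ia]].
  have := h1 a b; rewrite !inE size_take_min size_perm_seq !leq_min !ltn_ord.
  by rewrite bi (ltn_trans ab bi) !nth_take ?(ltn_trans ab bi) //
    !nth_perm_seq; apply.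
have ib := leq_trans ia (ltnW ab).
have := h2 (a - i)%N (b - i)%N; rewrite !inE size_drop size_perm_seq.
rewrite !nth_drop !subnKC // !nth_perm_seq; apply; rewrite ?ltn_sub2r //;
  have := ltn_ord a; have := ltn_ord b; lia.
Qed.

(** Shuffles of all types are the same as pairs of complementary increasing
    sequences. *)
Lemma sum_shuffles (V : zmodType) (F : seq 'I_N -> seq 'I_N -> V) :
  \sum_(0 <= i < N.+1) \sum_(s : 'S_N | shuffle i s)
     F (take i (perm_seq s)) (drop i (perm_seq s)) =
  \sum_(p <- splits (enum 'I_N)) F p.1 p.2.
Proof.
pose r2 i := [seq s <- index_enum 'S_N | shuffle i s].
pose h i s := (take i (perm_seq s), drop i (perm_seq s)).
transitivity (\sum_(p <- [seq h i s | i <- iota 0 N.+1, s <- r2 i]) F p.1 p.2).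
  rewrite big_allpairs_dep /index_iota subn0; apply: eq_bigr => i _.
  by rewrite /r2 big_filter.
apply: perm_big; apply: uniq_perm; last 1 first.
- move=> [I J]; rewrite mem_splits ?enum_lt_ord_sorted //.
  apply/allpairsPdep/and3P => [[i [s [_ + [-> ->]]]]|[sI sJ pIJ]].
    by rewrite mem_filter shuffleE cat_take_drop perm_seq_perm
      => /andP[/andP[-> ->]].
  have [s sE] := perm_seq_surj pIJ; exists (size I), s.
  rewrite /r2 /h mem_filter shuffleE sE take_size_cat // drop_size_cat // sI sJ.
  rewrite mem_index_enum mem_iota leq0n add0n ltnS; split=> //.
  have := perm_size pIJ; rewrite size_cat size_enum_ord => sN.
  by rewrite andTb -ltnS -[X in (_ < X.+1)%N]sN ltnS leq_addr.
- apply: allpairs_uniq_dep; first exact: iota_uniq.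
    by move=> i _; rewrite filter_uniq // index_enum_uniq.
  move=> [i s] [j t] /allpairsPdep[i' [s' [iN _ [-> ->]]]].
  move=> /allpairsPdep[j' [t' [jN _ [-> ->]]]] /= [tE dE].
  have st : s' = t'.
    by apply: perm_seq_inj; rewrite -[LHS](cat_take_drop i') tE dE
      cat_take_drop.
  move/(congr1 size): tE; rewrite !size_take_min !size_perm_seq.
  move: iN jN; rewrite !mem_iota !add0n !ltnS /= => iN jN.
  rewrite (minn_idPl iN) (minn_idPl jN) => ->.
  by rewrite st.
by rewrite splits_uniq ?enum_lt_ord_sorted.
Qed.

End Shuffles.

(** * Filtration by the number of arguments in A *)

Section Binary.
Variables (K : fieldType) (V : lmodType K).
Implicit Types (b c : V -> V -> V).

(** Bilinearity of a function of two variables of the same space. *)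
Definition biadditive b : Prop :=
  (forall a u v w, b (a *: u + v) w = a *: b u w + b v w) /\
  (forall a u v w, b w (a *: u + v) = a *: b w u + b w v).

Lemma binary_map_multilinear b : biadditive b -> multilinear 2 (binary_map b).
Proof.
move=> [bl br]; split=> [[|u [|v [|w s]]] //|s1 s2 a u v].
case: s1 => [|x [|y s1]]; case: s2 => [|z [|z' s2]] //=; lia.
Qed.

Lemma gbracket_binary b c : biadditive b -> biadditive c ->
  forall u v w, gbracket (binary_map b) (binary_map c) [:: u; v; w] =
  (b (c u v) w - b u (c v w)) + (c (b u v) w - c u (b v w)).
Proof.
move=> bb cb u v w.
rewrite (@gbracket_insertion _ _ 1 1 _ _ (binary_map_multilinear bb)
  (binary_map_multilinear cb)).
rewrite !fctE /= !expr1; module_eq K V.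
Qed.

Lemma gbracket_unary b (r : V -> V) : biadditive b -> 
  (forall a u v, r (a *: u + v) = a *: r u + r v) ->
  gbracket (binary_map b) (unary_map r) =
  binary_map (fun u v => b (r u) v + b u (r v) - r (b u v)).
Proof.
move=> bb rl.
have rm : multilinear 1 (unary_map r).
  split=> [[|u [|v s]] //|s1 s2 a u v].
  by case: s1 => [|x s1]; case: s2 => [|z s2] //=; rewrite ?addnS //; lia.
have gm := @gbracket_multilinear _ _ 1 0 _ _ (binary_map_multilinear bb) rm.
apply/funext => -[|u [|v [|w s]]]; try by rewrite gm.1.
rewrite (@gbracket_insertion _ _ 1 0 _ _ (binary_map_multilinear bb) rm) muln0.
by rewrite !fctE /= !expr0; module_eq K V.
Qed.

End Binary.

Section Weight.
Variables (K : fieldType) (A B : lmodType K).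
Implicit Types f g h : seq (A * B) -> A * B.

(** Number of arguments lying in [A]. *)
Definition countA (s : seq (A * B)) : nat := count (fun v => v.2 == 0) s.

(** Step [w] of the filtration: [f] vanishes on more than [w] arguments from
    [A], the others being arbitrary, and takes values in [A] on at least [w] of
    them. *)
Definition filtered (w : nat) f : Prop := forall s,
  ((w < countA s)%N -> f s = 0) /\ ((w <= countA s)%N -> (f s).2 = 0).

(** If [g] gets at most [w2 - 1] of the arguments from [A], too many remain for
    [f]; if it gets [w2] of them, its value lies in [A] and replaces them. *)
Lemma gcirc_filtered m n w1 w2 f g s : slot_linear f -> filtered w1 f ->
  filtered w2 g ->
  ((w1 + w2 <= countA s)%N -> gcirc m n f g s = 0) /\
  ((w1 + w2 <= (countA s).+1)%N -> (gcirc m n f g s).2 = 0).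
Proof.
move=> fl fw gw; rewrite /gcirc; case: ifP => _; last by [].
have cA i : countA s = (countA (take i s) + (countA (take n (drop i s)) +
    countA (drop (i + n) s)))%N.
  by rewrite -!count_cat addnC -drop_drop !cat_take_drop.
have cF i x : countA (take i s ++ x :: drop (i + n) s) =
    ((x.2 == 0)%R + (countA (take i s) + countA (drop (i + n) s)))%N.
  by rewrite /countA count_cat /= addnCA.
pose F i := f (take i s ++ g (take n (drop i s)) :: drop (i + n) s).
suff h i : ((w1 + w2 <= countA s)%N -> F i = 0) /\
           ((w1 + w2 <= (countA s).+1)%N -> (F i).2 = 0).
  split=> hs.
    by apply: big1 => i _; have := (h i).1 hs; rewrite /F => ->;
      rewrite scaler0.
  elim/big_rec: _ => [//|i x _ /= ->]; have := (h i).2 hs.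
  by rewrite /F => ->; rewrite scaler0 addr0.
rewrite {}/F; set t := take n _; set s' := _ ++ _.
have := cF i (g t); rewrite -/s' (cA i) -/t.
have [gt ct] := gw t.
have [h1|h1] := ltnP w2 (countA t).
  by have -> : f s' = 0 by rewrite /s' gt // (slot_linear0 fl).
have [f0 f2] := fw s'.
have [tw|tw] := eqVneq (countA t) w2.
  by rewrite ct ?tw // eqxx => s'E; split=> hs; [apply: f0|apply: f2]; lia.
by move=> s'E; split=> hs; [apply: f0|apply: f2]; lia.
Qed.

Lemma gbracket_filtered w1 w2 f g s : slot_linear f -> slot_linear g ->
  filtered w1 f -> filtered w2 g ->
  ((w1 + w2 <= countA s)%N -> gbracket f g s = 0) /\
  ((w1 + w2 <= (countA s).+1)%N -> (gbracket f g s).2 = 0).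
Proof.
move=> fl gl fw gw; rewrite /gbracket.
have h m n : ((w1 + w2 <= countA s)%N -> gbracket_arity m n f g s = 0) /\
    ((w1 + w2 <= (countA s).+1)%N -> (gbracket_arity m n f g s).2 = 0).
  rewrite /gbracket_arity !fctE.
  have [f1 f2] := gcirc_filtered m n s fl fw gw.
  have [g1 g2] := gcirc_filtered n m s gl gw fw.
  split=> hs; first by rewrite f1 // g1 1?addnC // scaler0 subr0.
  by rewrite /= f2 // g2 1?addnC // scaler0 subr0.
split=> hs; first by apply: big1 => i _; exact: (h _ _).1.
by elim/big_rec: _ => [//|i x _ xE];
  rewrite [LHS](linearD snd) [X in _ + X]xE addr0; exact: (h _ _).2.
Qed.

(** Step 0 is the space of maps from powers of [B] to [A]. *)
Definition lowest f : Prop := slot_linear f /\ filtered 0 f.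

Lemma lowest_abelian f g : lowest f -> lowest g -> gbracket f g = 0.
Proof.
move=> [fl f0] [gl g0]; by apply/funext => s;
  apply: (gbracket_filtered s fl gl f0 g0).1.
Qed.

Lemma filtered_gbracket w f g : slot_linear f -> slot_linear g ->
  filtered w.+1 f -> filtered 0 g -> filtered w (gbracket f g).
Proof.
move=> fl gl fw g0 s; have := gbracket_filtered s fl gl fw g0.
by rewrite addn0 ltnS.
Qed.

Lemma extend_multilinear n (phi : seq B -> A) :
  multilinear n phi -> multilinear n (extend phi).
Proof.
move=> [p0 pl]; split=> [s sn|s1 s2 a u v sE].
  by rewrite /extend p0 // size_map.
rewrite /extend !map_cat /= pl ?size_map //.
by congr (_, _); rewrite /= scaler0 addr0.
Qed.

Lemma extend_filtered (phi : seq B -> A) : slot_linear phi ->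
  filtered 0 (extend phi).
Proof.
move=> pl s; split=> [|//];
  rewrite -has_count => /hasP[[a x] /splitPr[s1 s2] /= /eqP->].
by rewrite /extend map_cat /= (slot_linear0 pl).
Qed.

Lemma filtered_extend n f : multilinear n f -> filtered 0 f ->
  exists2 phi : seq B -> A, multilinear n phi & f = extend phi.
Proof.
move=> fm f0; have fl := multilinear_slot fm.
exists (fun s => (f (map (pair 0) s)).1).
  split=> [s sn|s1 s2 a u v sE]; first by rewrite fm.1 // size_map.
  rewrite !map_cat /= (_ : (0, _) = a *: ((0 : A), u) + (0, v)) ?fl //.
  by congr (_, _); rewrite /= scaler0 addr0.
apply/funext => s; rewrite /extend.
suff h : forall t, f (t ++ s) = f (t ++ map (pair 0) (map snd s)).
  by rewrite (h [::] : f s = _) [LHS]surjective_pairing (f0 _).2.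
elim: s => [//|[a x] s IHs] t.
have aE : (a, x) = (a, 0) + (0, x) :> A * B by congr (_, _);
  rewrite /= ?addr0 ?add0r.
rewrite [in LHS]aE (slot_linearD fl) (f0 (t ++ (a, 0) :: s)).1; last first.
  by rewrite /countA count_cat /= eqxx addnCA.
by rewrite add0r; have := IHs (rcons t (0, x)); rewrite !cat_rcons => ->.
Qed.

Lemma b_gradedP (n : nat) f : b_graded n f <->
  multilinear n.+1 f /\ filtered 0 f.
Proof.
split=> [[phi pm ->]|[fm f0]]; last exact: filtered_extend.
split; first exact: extend_multilinear.
exact/extend_filtered/(multilinear_slot pm).
Qed.

Lemma b_graded_admissible (d : int) f : b_graded d f ->
  admissible lowest (odd `|d|%N, f).
Proof.
case: d => n /=.
  move=> [phi pm ->].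
  have /b_gradedP[fm f0] : b_graded n (extend phi) by exists phi.
  by do 2?split=> //; [exists n|exact: multilinear_slot fm].
by move=> ->; do 2?split=> //;
  [exact: parity_elt0|exact: parity_slot (parity_elt0 _ true)].
Qed.

Lemma b_graded_slot (d : int) f : b_graded d f -> slot_linear f.
Proof. by case/b_graded_admissible => /parity_slot. Qed.

End Weight.

(** * The L-infinity algebra of a quasi-twilled algebra *)

Section Parts.
Variables (K : fieldType) (A B : lmodType K) (Q : quasi_twilled A B).

(** Component of the product in step [k] of the filtration; it is 0 unless [k]
    is 1, 2 or 3. *)
Definition qt_part (k : nat) (u v : A * B) : A * B :=
  match k with
  | 1 => (qt_hl Q u.1 v.2 + qt_hr Q u.2 v.1, qt_nu Q u.2 v.2)
  | 2 => (qt_mu Q u.1 v.1, qt_tr Q u.1 v.2 + qt_tl Q u.2 v.1)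
  | 3 => (0, qt_theta Q u.1 v.1)
  | _ => 0
  end.

Definition qt_comp (k : nat) : seq (A * B) -> A * B := binary_map (qt_part k).

Lemma qt_part_biadditive k : biadditive (qt_part k).
Proof.
by split=> a u v w; case: k => [|[|[|[|k]]]] /=;
  rewrite ?scaler0 ?addr0 //; congr (_, _);
  rewrite /= ?(linearPl, linearPr) ?scaler0 ?addr0 //;
  rewrite ?scalerDr; exact: addrACA.
Qed.

Lemma qt_comp_multilinear k : multilinear 2 (qt_comp k).
Proof. exact/binary_map_multilinear/qt_part_biadditive. Qed.

Lemma qt_comp_filtered k : filtered k (qt_comp k).
Proof.
move=> [|[a x] [|[b y] [|w s]]] //=; rewrite /qt_comp /countA /=.
case: k => [|[|[|[|k]]]] //=.
- rewrite addn0; split; first by case: (eqVneq x 0) (eqVneq y 0) =>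
  [->|?] [->|?] //; rewrite linear0r linear0l linear0l addr0.
  by case: (eqVneq x 0) (eqVneq y 0) => [->|?] [->|?] //;
    rewrite ?linear0r ?linear0l.
- split; first by case: (_ == _); case: (_ == _).
  by case: (eqVneq x 0) (eqVneq y 0) => [->|?] [->|?] //;
    rewrite linear0r linear0l addr0.
- by split; case: (_ == _); case: (_ == _).
Qed.

Lemma slot_linear_pure3 (F : seq (A * B) -> A * B) : slot_linear F ->
  (forall p q r : bool, forall a x b y c z,
     F [:: if p then (a, 0) else (0, x); if q then (b, 0) else (0, y);
           if r then (c, 0) else (0, z)] = 0) ->
  forall u v w, F [:: u; v; w] = 0.
Proof.
move=> Fl h [a x] [b y] [c z].
have dec (a' : A) (x' : B) : (a', x') = (a', 0) + (0, x').
  by congr (_, _); rewrite /= ?addr0 ?add0r.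
rewrite (dec a x) (dec b y) (dec c z) (slot_linearD Fl [::]) /=.
rewrite !(slot_linearD Fl [:: _]) /= !(slot_linearD Fl [:: _; _]) /=.
rewrite (h true true true a x b y c z) (h true true false a x b y c z).
rewrite (h true false true a x b y c z) (h true false false a x b y c z).
rewrite (h false true true a x b y c z) (h false true false a x b y c z).
rewrite (h false false true a x b y c z) (h false false false a x b y c z).
by rewrite !addr0.
Qed.

Lemma slot_linear_sum n (F : 'I_n -> seq (A * B) -> A * B) :
  (forall i, slot_linear (F i)) -> slot_linear (\sum_i F i).
Proof.
move=> h; elim/big_ind: _ => [|f g fl gl|i _]; last exact: h.
  by move=> s1 s2 a u v; rewrite scaler0 addr0.
by move=> s1 s2 a u v; rewrite !fctE fl gl; module_eq K (A * B)%type.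
Qed.

Let simp := (linear0l, linear0r, addr0, add0r, oppr0, subr0, sub0r).

Lemma eq0_double (W : lmodType K) (L R X : W) :
  L = R -> X = 2%:R *: (R - L) -> X = 0.
Proof. by move=> -> ->; rewrite subrr scaler0. Qed.

(** Associativity of the product. *)
Lemma qt_comp_sq N : \sum_(p < N.+1) gbracket (qt_comp p) (qt_comp (N - p)%N) =
  0.
Proof.
set F := \sum_(p < _) _.
have gm p q : multilinear 3 (gbracket (qt_comp p) (qt_comp q)).
  by apply: (@gbracket_multilinear _ _ 1 1); exact: qt_comp_multilinear.
have Fl : slot_linear F.
  by apply: slot_linear_sum => i; exact: multilinear_slot (gm _ _).
apply/funext => s; have [s3|s3] := eqVneq (size s) 3; last first.
  by rewrite /F fct_sumE big1 // => p _; rewrite (gm _ _).1.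
case: s s3 => [|u [|v [|w [|? ?]]]] //= _;
  apply: slot_linear_pure3 => // {u v w}.
move=> p q r a x b y c z; rewrite /F fct_sumE.
under eq_bigr => i _ do rewrite
  (gbracket_binary (qt_part_biadditive _) (qt_part_biadditive _)).
have := qt_mulA Q (if p then (a, 0) else (0, x)) (if q then (b, 0) else (0, y))
           (if r then (c, 0) else (0, z)).
set u := if p then _ else _; set v := if q then _ else _;
  set w := if r then _ else _.
rewrite -(big_mkord xpredT (fun i => qt_part i (qt_part (N - i) u v) w -
  qt_part i u (qt_part (N - i) v w) + (qt_part (N - i) (qt_part i u v) w -
  qt_part (N - i) u (qt_part i v w)))).
move/[dup] => /(congr1 fst) + /(congr1 snd).
have part0 k u' v' : (3 < k)%N -> qt_part k u' v' = 0.
  by case: k => [|[|[|[|k]]]].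
have part0l k v' : qt_part k 0 v' = 0.
  by have := (qt_part_biadditive k).1 (-1) 0 0 v';
    rewrite scaler0 addr0 scaleN1r addNr.
have part0r k u' : qt_part k u' 0 = 0.
  by have := (qt_part_biadditive k).2 (-1) 0 0 u';
    rewrite scaler0 addr0 scaleN1r addNr.
have [N7|N7] := ltnP 6 N.
  move=> _ _; rewrite big_nat big1 // => i iN.
  have [i3|i3] := ltnP 3 i;
    first by rewrite !(part0 i) // !part0r !part0l !subr0 addr0.
  by rewrite !(part0 (N - i)%N) ?part0r ?part0l ?subr0 ?addr0 //; lia.
have pair0 (t : A * B) : t.1 = 0 -> t.2 = 0 -> t = 0.
  by move=> t1 t2; rewrite [t]surjective_pairing t1 t2.
rewrite /qt_mul {part0 part0l part0r}/u {}/v {}/w; case: p; case: q; case: r;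
  case: N N7 {F Fl} => [|[|[|[|[|[|[|//]]]]]]] _; rewrite unlock /= => H1 H2;
  apply: pair0 => /=.
(* Each value that does not cancel is twice a component of the associator. *)
all: rewrite ?simp //.
all: rewrite ?simp in H1 H2.
all: first [apply: (eq0_double H1); module_eq K A | apply: (eq0_double H2);
  module_eq K B].
Qed.

End Parts.

(** Multilinearity of the operations is needed on sums of maps of different
    degrees, whose bracket is computed one number of arguments at a time. *)
Section SlotBracket.
Variables (K : fieldType) (V : lmodType K).
Implicit Types f g : seq V -> V.

(** The component of [f] with [n] arguments. *)
Definition arity_part (n : nat) f : seq V -> V :=
  fun s => if size s == n then f s else 0.

Lemma arity_part_multilinear n f : slot_linear f ->
  multilinear n (arity_part n f).
Proof.
move=> fl; split=> [s /negbTE sn|s1 s2 a u v <-];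
  first by rewrite /arity_part sn.
by rewrite /arity_part !size_cat /= eqxx fl.
Qed.

Lemma gcirc_arity_part m n f g s : slot_linear f ->
  gcirc m n.+1 (arity_part m f) (arity_part n.+1 g) s = gcirc m n.+1 f g s.
Proof.
move=> fl; rewrite /gcirc; case: eqP => // sE; rewrite big_nat [RHS]big_nat.
apply: eq_bigr => i /andP[_ im]; congr (_ *: _).
have tE : size (take n.+1 (drop i s)) = n.+1.
  by rewrite size_take size_drop; case: ifP; lia.
rewrite /arity_part tE eqxx.
suff -> : size (take i s ++ g (take n.+1 (drop i s)) :: drop (i + n.+1) s) == m
  by [].
by rewrite size_cat /= size_take size_drop; case: ifP; lia.
Qed.

Lemma gbracket_arity_part f g s : slot_linear f -> slot_linear g ->
  gbracket f g s = \sum_(1 <= m < (size s).+1)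
    gbracket (arity_part m f) (arity_part (size s - m).+1 g) s.
Proof.
move=> fl gl; rewrite /gbracket [LHS]big_nat [RHS]big_nat.
apply: eq_bigr => -[//|m] /andP[_ ms]; rewrite -/(gbracket _ _ s).
rewrite (@gbracket_homogeneous _ _ m.+1 (size s - m.+1).+1) //;
  try exact: arity_part_multilinear.
by rewrite /gbracket_arity !fctE !gcirc_arity_part.
Qed.

Lemma gbracket_slot_linear f g : slot_linear f -> slot_linear g ->
  slot_linear (gbracket f g).
Proof.
move=> fl gl s1 s2 a u v; rewrite !gbracket_arity_part //.
rewrite !size_cat /= scaler_sumr -big_split big_nat [RHS]big_nat.
apply: eq_bigr => -[//|m] _ /=.
have := gbracket_multilinear (arity_part_multilinear m.+1 fl)
  (arity_part_multilinear (size s1 + (size s2).+1 - m.+1).+1 gl).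
by move/multilinear_slot => ->.
Qed.

Lemma foldl_slot_linear f fs : slot_linear f ->
  {in fs, forall g, slot_linear g} ->
  slot_linear (foldl (@gbracket _ _) f fs).
Proof.
elim: fs f => [//|g fs IHfs] f fl h /=; apply: IHfs => [|g' g'fs].
  by apply: gbracket_slot_linear => //; apply: h; rewrite inE eqxx.
by apply: h; rewrite inE g'fs orbT.
Qed.

Lemma foldl_gbracket_lin a f f' gs : {in gs, forall g, slot_linear g} ->
  foldl (@gbracket _ _) (a *: f + f') gs =
    a *: foldl (@gbracket _ _) f gs + foldl (@gbracket _ _) f' gs.
Proof.
elim: gs f f' => [//|g gs IHgs] f f' h /=.
rewrite gbracket_linl ?IHgs //; first by move=> g' g'gs; apply: h;
  rewrite inE g'gs orbT.
by apply: h; rewrite inE eqxx.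
Qed.

Lemma foldl_gbracket_slot_lin f a g g' gs1 gs2 : slot_linear f ->
  {in gs1, forall g, slot_linear g} -> {in gs2, forall g, slot_linear g} ->
  foldl (@gbracket _ _) f (gs1 ++ (a *: g + g') :: gs2) =
  a *: foldl (@gbracket _ _) f (gs1 ++ g :: gs2) + foldl (@gbracket _ _) f
    (gs1 ++ g' :: gs2).
Proof.
move=> fl h1 h2; rewrite !foldl_cat /= gbracket_linr ?foldl_gbracket_lin //.
exact: foldl_slot_linear.
Qed.

Lemma foldl_gbracket0 f gs : slot_linear f ->
  {in gs, forall g, slot_linear g} ->
  0 \in gs -> foldl (@gbracket _ _) f gs = 0.
Proof.
move=> fl + /splitPr gsE; case: gsE => gs1 gs2 h.
have h1 : {in gs1, forall g, slot_linear g}.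
  by move=> g gg; apply: h; rewrite mem_cat gg.
have h2 : {in gs2, forall g, slot_linear g}.
  by move=> g gg; apply: h; rewrite mem_cat inE gg !orbT.
have := foldl_gbracket_slot_lin (-1) 0 0 fl h1 h2.
by rewrite scaler0 addr0 scaleN1r addNr.
Qed.

Lemma foldl_multilinear (I : Type) m (n : I -> nat) (x : I -> seq V -> V) ks f :
  multilinear m.+1 f -> (forall i, multilinear (n i).+1 (x i)) ->
  multilinear (m + \sum_(i <- ks) n i).+1
    (foldl (@gbracket _ _) f [seq x i | i <- ks]).
Proof.
move=> + xm; elim: ks m f => [|k ks IHks] m f fm /=;
  first by rewrite big_nil addn0.
by rewrite big_cons addnA; apply/IHks/gbracket_multilinear.
Qed.

Lemma total_space_slot_linear (G : int -> (seq V -> V) -> Prop) f :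
  (forall d g, G d g -> slot_linear g) -> total_space G f -> slot_linear f.
Proof.
move=> Gl [n [d [x [xG ->]]]]; elim/big_ind: _ => [|g h gl hl|i _].
- by move=> s1 s2 a u v; rewrite scaler0 addr0.
- by move=> s1 s2 a u v; rewrite !fctE gl hl; module_eq K V.
exact: Gl (xG i).
Qed.

End SlotBracket.

Section NestedSymmetry.
Variables (K : fieldType) (V : lmodType K).
Let E := seq V -> V.
Variables (abel : E -> Prop).
Hypothesis abelC : forall f g, abel f -> abel g -> gbracket f g = 0.
Implicit Types (z : bool * E) (zs I J L : seq (bool * E)).

Lemma nestedE (f : E) zs : nested f zs = foldl (@gbracket _ _) f (map snd zs).
Proof. by elim: zs f => [//|z zs IHzs] f /=. Qed.

Lemma nested_cat (f : E) I J : nested f (I ++ J) = nested (nested f I) J.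
Proof. exact: foldl_cat. Qed.

Lemma nested_block_swap e (f : E) I J L :
  parity_elt e f -> {in I ++ J ++ L, forall z, admissible abel z} ->
  nested f (I ++ J ++ L) =
  parity_sign K (total_parity I && total_parity J) *: nested f (J ++ I ++ L).
Proof.
elim: J e f => [|z J IHJ] e f fe h; first by rewrite /= andbF scale1r.
have Ig : {in I, forall z, admissible abel z} by move=> y yI; apply: h;
  rewrite mem_cat yI.
have zg : admissible abel z by apply: h; rewrite mem_cat inE eqxx orbT.
have JLg : {in J ++ L, forall z, admissible abel z}.
  by move=> y yI; apply: h; rewrite mem_cat inE yI !orbT.
rewrite nested_cat /= (nested_swap abelC fe zg Ig) (nestedZ _ _ JLg).
rewrite -[nested (nested _ I) _]nested_cat (IHJ _ _ (parity_gbracket fe zg.1)).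
  rewrite scalerA -parity_signD; congr (parity_sign _ _ *: _).
  by case: (total_parity I) z.1 (total_parity J) => -[] [].
by move=> y; rewrite mem_cat => /orP[/Ig//|/JLg].
Qed.

(** Iterated brackets along an abelian subspace are graded symmetric. *)
Lemma nested_perm e (f : E) N (p : 'I_N -> bool) (x : 'I_N -> E) ks ks' :
  parity_elt e f -> (forall i, admissible abel (p i, x i)) -> uniq ks ->
    perm_eq ks ks' ->
  let z := map (fun i => (p i, x i)) in
  koszul_seq K p ks' *: nested f (z ks') = koszul_seq K p ks *: nested f (z ks).
Proof.
move=> fe xg ks_uniq kk' z.
pose P t := uniq t /\
  koszul_seq K p t *: nested f (z t) = koszul_seq K p ks *: nested f (z ks).
have [] // : P ks'; apply: (catCA_perm_ind _ kk'); last by split.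
move=> I J L [IJL hE]; split; first by rewrite uniq_catCA.
rewrite -hE.
have par t : total_parity (z t) = parity_seq p t by elim: t => //= i t ->.
have zg t : {in z t, forall y, admissible abel y} by move=> y /mapP[i _ ->].
rewrite /z !map_cat (@nested_block_swap e f (z I)) // -?map_cat //.
rewrite !par -cross_swap; last by move: IJL; rewrite catA cat_uniq => /and3P[].
rewrite !koszul_seq_cat !cross_catr scalerA; congr (_ *: _).
have := cross_sq K p I J; move: (cross _ _ _ _) => c hc; ring: hc.
Qed.

End NestedSymmetry.

Section UntwistedAlgebra.
Variables (K : fieldType) (A B : lmodType K) (Q : quasi_twilled A B).
Let E := seq (A * B) -> A * B.
Implicit Types (f g : E) (zs : seq (bool * E)).

(** The derived brackets of the components. On the empty list this is the
    component 0, so 0; on more than three elements it is 0 too. *)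
Definition qt_op (s : seq E) : E := foldl (@gbracket _ _) (qt_comp Q (size s))
  s.

Local Notation admissible := (admissible (@lowest K A B)).

Lemma qt_comp_odd k : parity_elt true (qt_comp Q k).
Proof. by exists 1; last exact: qt_comp_multilinear. Qed.

Lemma qt_comp0 : qt_comp Q 0 = 0.
Proof. by apply/funext => -[|u [|v [|w s]]]. Qed.

Lemma qt_comp_gt3 k : (3 < k)%N -> qt_comp Q k = 0.
Proof. by case: k => [|[|[|[|k]]]] // _; apply/funext => -[|u [|v [|w s]]]. Qed.

Lemma nested_filtered e f w zs : parity_elt e f ->
  {in zs, forall z, admissible z} ->
  filtered (size zs + w) f -> filtered w (nested f zs).
Proof.
elim: zs e f => [//|z zs IHzs] e f fe /admissible_cons[[zp z0] zsg] fw /=.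
apply: (IHzs _ _ (parity_gbracket fe zp) zsg).
by apply: filtered_gbracket => //;
  [exact: parity_slot fe|exact: z0.1|exact: z0.2].
Qed.

Lemma nested_comp_lowest zs : {in zs, forall z, admissible z} ->
  lowest (nested (qt_comp Q (size zs)) zs).
Proof.
move=> zsg; split; first exact: parity_slot (nested_parity (qt_comp_odd _) zsg).
apply: (nested_filtered (qt_comp_odd _) zsg).
by rewrite addn0; exact: qt_comp_filtered.
Qed.

Lemma nested_comp_gt zs k : {in zs, forall z, admissible z} ->
  (k < size zs)%N ->
  nested (qt_comp Q k) zs = 0.
Proof.
move=> zsg kz; rewrite -(cat_take_drop k zs) nested_cat.
have tg : {in take k zs, forall z, admissible z} by move=> z /mem_take/zsg.
have dg : {in drop k zs, forall z, admissible z} by move=> z /mem_drop/zsg.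
have : size (drop k zs) != 0%N by rewrite size_drop subn_eq0 -ltnNge.
have := nested_comp_lowest tg; rewrite size_takel ?(ltnW kz) // => fl.
case: (drop k zs) dg => [//|z zs'] /admissible_cons[[zp z0] zg] _ /=.
by rewrite lowest_abelian ?(nested0 zg).
Qed.

Lemma qt_opE zs : qt_op (map snd zs) = derived_op (qt_comp Q) zs.
Proof. by rewrite /qt_op /derived_op nestedE size_map. Qed.

Lemma qt_op0 s : {in s, forall g, slot_linear g} -> qt_op (0 :: s) = 0.
Proof.
move=> sl; apply: foldl_gbracket0; rewrite ?inE ?eqxx //.
  exact: parity_slot (qt_comp_odd _).
move=> g; rewrite inE => /predU1P[->|/sl//].
exact: parity_slot (parity_elt0 _ true).
Qed.

Lemma b_graded0 d : @b_graded K A B d 0.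
Proof.
by case: d => n //; apply/b_gradedP; split; [exact: multilinear0|split].
Qed.

Lemma b_graded_space : graded_space (@b_graded K A B).
Proof.
split=> [d|d a u v|D x Du xd xs d dD]; first exact: b_graded0.
  case: d => n; last by move=> -> ->; rewrite scaler0 addr0.
  move=> /b_gradedP[um u0] /b_gradedP[vm v0]; apply/b_gradedP.
  split=> [|s]; first exact: multilinear_lin.
  have [[u1 u2] [v1 v2]] := (u0 s, v0 s).
  rewrite !fctE; split=> cs; first by rewrite (u1 cs) (v1 cs) scaler0 addr0.
  by rewrite /= (u2 cs) (v2 cs) scaler0 addr0.
have := xd d; case: d dD => n dD; last by [].
move=> /b_gradedP[xm _]; apply/funext => s.
have [sn|sn] := eqVneq (size s) n.+1; last exact: xm.1.
have := congr1 (fun f : E => f s) xs; rewrite fct_sumE (bigD1_seq _ dD Du) /=.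
rewrite big1 ?addr0 // => -[m|m] md; last by have := xd (Negz m) => ->.
have /b_gradedP[ym _] := xd (Posz m); rewrite ym.1 // sn eqSS.
by apply: contra_neq md => ->.
Qed.

Lemma qt_op_multilinear : forall s1 s2 (a : K) u v,
  (forall w, w \in s1 ++ u :: v :: s2 -> total_space (@b_graded K A B) w) ->
  qt_op (s1 ++ (a *: u + v) :: s2) =
  a *: qt_op (s1 ++ u :: s2) + qt_op (s1 ++ v :: s2).
Proof.
move=> s1 s2 a u v tw.
have sl w : w \in s1 ++ u :: v :: s2 -> slot_linear w.
  by move/tw; apply: total_space_slot_linear => d g; exact: b_graded_slot.
rewrite /qt_op !size_cat /= foldl_gbracket_slot_lin //.
- exact: parity_slot (qt_comp_odd _).
- by move=> w w1; apply: sl; rewrite mem_cat w1.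
by move=> w w1; apply: sl; rewrite mem_cat !inE w1 !orbT.
Qed.

Lemma qt_op_degree k (d : 'I_k -> int) (x : 'I_k -> E) : (0 < k)%N ->
  (forall i, b_graded (d i) (x i)) ->
  b_graded (\sum_i d i + 1) (qt_op [seq x i | i : 'I_k]).
Proof.
move=> _ xd.
have xsl : {in [seq x i | i : 'I_k], forall g, slot_linear g}.
  by move=> g /mapP[i _ ->]; exact: b_graded_slot (xd i).
(* An element of negative degree is 0. *)
have [i di|dpos] := pickP (fun i => if d i is Negz _ then true else false).
  rewrite /qt_op foldl_gbracket0 //; first exact: b_graded0.
    exact: parity_slot (qt_comp_odd _).
  apply/mapP; exists i; first by rewrite mem_enum.
  by have := xd i; case: (d i) di.
have dE i : d i = Posz `|d i|%N by have := dpos i; case: (d i).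
have -> : \sum_i d i + 1 = (1 + \sum_i `|d i|)%N.
  rewrite addrC PoszD; congr (_ + _).
  by rewrite (big_morph Posz PoszD (erefl _)); apply: eq_bigr => i _; exact: dE.
apply/b_gradedP; split.
  rewrite -big_enum; apply: foldl_multilinear; first exact: qt_comp_multilinear.
  by move=> i; have := xd i; rewrite dE => /b_gradedP[].
have -> : [seq x i | i : 'I_k] = map snd [seq (odd `|d i|%N, x i) | i : 'I_k].
  by rewrite -map_comp.
rewrite qt_opE; apply: (nested_comp_lowest _).2.
by move=> z /mapP[i _ ->]; exact: b_graded_admissible.
Qed.

Lemma qt_op_symmetric k (d : 'I_k -> int) (x : 'I_k -> E) (s : 'S_k) :
  (0 < k)%N -> (forall i, b_graded (d i) (x i)) ->
  qt_op [seq x i | i : 'I_k] = koszul K d s *: qt_op [seq x (s i) | i : 'I_k].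
Proof.
case: k d x s => [//|n] d x s _ xd; pose p i := odd `|d i|%N.
have xg i : admissible (p i, x i) by exact: b_graded_admissible.
pose z := map (fun i => (p i, x i)).
have -> : [seq x i | i : 'I_n.+1] =
  map snd (z (enum 'I_n.+1)) by rewrite /z -map_comp.
have -> : [seq x (s i) | i : 'I_n.+1] = map snd (z (perm_seq s)).
  by rewrite /z /perm_seq -map_comp -map_comp.
have sz t : size (z t) = size t := size_map _ _.
rewrite !qt_opE /derived_op !sz size_perm_seq size_enum_ord.
rewrite (koszul_seqE K s (fun i => erefl (p i))).
have ps : perm_eq (enum 'I_n.+1) (perm_seq s) by rewrite perm_sym perm_seq_perm.
rewrite (nested_perm (@lowest_abelian _ _ _) (qt_comp_odd _) xg (enum_uniq _)
  ps).
by rewrite koszul_seq_sorted ?scale1r // enum_lt_ord_sorted.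
Qed.

Hypothesis two_neq0 : 2%:R != 0 :> K.

Lemma qt_op_jacobi N (d : 'I_N -> int) (x : 'I_N -> E) : (0 < N)%N ->
  (forall i, b_graded (d i) (x i)) ->
  \sum_(1 <= i < N.+1) \sum_(s : 'S_N | shuffle i s)
    koszul K d s *:
      (let y := [seq x (s j) | j : 'I_N] in qt_op
        (qt_op (take i y) :: drop i y)) = 0.
Proof.
case: N d x => [//|n] d x _ xd; pose p i := odd `|d i|%N.
have xg i : admissible (p i, x i) by exact: b_graded_admissible.
pose z := map (fun i => (p i, x i)).
have zg t : {in z t, forall y, admissible y} by move=> y /mapP[i _ ->].
pose F I J := koszul_seq K p (I ++ J) *: qt_op (qt_op (map x I) :: map x J).
transitivity (\sum_(0 <= i < n.+2) \sum_(s : 'S_n.+1 | shuffle i s)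
    F (take i (perm_seq s)) (drop i (perm_seq s))).
  (* The term i = 0 vanishes, because the operation on the empty list is 0. *)
  rewrite [RHS]big_nat_recl // [X in _ = X + _]big1 ?add0r => [|s _];
    last first.
    rewrite /F take0 /= {2}/qt_op /= qt_comp0 qt_op0 ?scaler0 // => g.
    by move=> /mapP[i _ ->]; exact: b_graded_slot (xd _).
  rewrite big_add1 /=; apply: eq_bigr => i _; apply: eq_bigr => s _.
  rewrite /F cat_take_drop (koszul_seqE K s (fun i => erefl (p i))).
  have -> : [seq x (s j) | j : 'I_n.+1] = map x (perm_seq s).
    by rewrite /perm_seq -map_comp.
  by rewrite map_take map_drop.
rewrite sum_shuffles.
rewrite -[RHS](derived_jacobi two_neq0 qt_comp_odd (qt_comp_sq Q)
  (@lowest_abelian _ _ _) nested_comp_lowest nested_comp_gt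
    (zg (enum 'I_n.+1))).
rewrite (@unshuffle_splits _ _ _ _ p x) ?enum_lt_ord_sorted //.
rewrite big_seq [RHS]big_seq; apply: eq_bigr => -[I J].
rewrite mem_splits ?enum_lt_ord_sorted // => /and3P[sI sJ _] /=.
rewrite /F koszul_seq_cat !koszul_seq_sorted // mul1r mulr1; congr (_ *: _).
have mE t : map x t = map snd (z t) by rewrite /z -map_comp.
by rewrite !mE -qt_opE /= qt_opE.
Qed.

Lemma quasi_twilled_L_infinity : L_infinity_algebra (@b_graded K A B) qt_op.
Proof.
split.
- exact: b_graded_space.
- exact: qt_op_multilinear.
- exact: qt_op_degree.
- exact: qt_op_symmetric.
- exact: qt_op_jacobi.
Qed.

End UntwistedAlgebra.

(** * Twisting by a weak deformation map *)

(** Being an L-infinity algebra only depends on the operations on a space [P]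
    that contains the graded space and is closed under them. *)
Lemma L_infinity_transfer (K : fieldType) (E : lmodType K)
  (G : int -> E -> Prop)
    (P : E -> Prop) (l l' : seq E -> E) :
  (forall u, total_space G u -> P u) ->
  (forall a u v, P u -> P v -> P (a *: u + v)) ->
  (forall s, {in s, forall u, P u} -> P (l s)) ->
  (forall s, {in s, forall u, P u} -> l s = l' s) ->
  L_infinity_algebra G l -> L_infinity_algebra G l'.
Proof.
move=> GP Plin lP ll' [Gg lm ld ls lj].
have GP1 d u : G d u -> P u.
  move=> Gu; apply: GP; exists 1%N, (fun=> d), (fun=> u).
  by split; rewrite ?big_ord1.
have xP N (d : 'I_N -> int) (x : 'I_N -> E) : (forall i, G (d i) (x i)) ->
    forall t : seq 'I_N, {in [seq x i | i <- t], forall u, P u}.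
  by move=> xG t _ /mapP[i _ ->]; exact: GP1 (xG i).
split=> //.
- move=> s1 s2 a u v h; have hP : {in s1 ++ u :: v :: s2, forall w, P w}.
    by move=> w /h/GP.
  have s1P : {in s1, forall w, P w} by move=> w w1; apply: hP;
    rewrite mem_cat w1.
  have s2P : {in s2, forall w, P w}.
    by move=> w w2; apply: hP; rewrite mem_cat !inE w2 !orbT.
  have uP : P u by apply: hP; rewrite mem_cat inE eqxx orbT.
  have vP : P v by apply: hP; rewrite mem_cat !inE eqxx !orbT.
  have sP w : P w -> {in s1 ++ w :: s2, forall w, P w}.
    by move=> wP w'; rewrite mem_cat inE => /or3P[/s1P|/eqP->|/s2P].
  by rewrite -!ll'; [exact: lm|exact: sP|exact: sP|exact/sP/Plin].
- move=> k d x k0 xG; rewrite -ll'; first exact: ld.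
  exact: xP xG (enum _).
- move=> k d x s k0 xG; rewrite -!ll'; first exact: ls.
    by move=> _ /mapP[i _ ->]; exact: GP1 (xG _).
  exact: xP xG (enum _).
move=> N d x N0 xG; rewrite -[RHS](lj N d x N0 xG).
apply: eq_bigr => i _; apply: eq_bigr => s _; congr (_ *: _) => /=.
have yP : {in [seq x (s j) | j : 'I_N], forall u, P u}.
  by move=> _ /mapP[j _ ->]; exact: GP1 (xG _).
have tP : {in take i [seq x (s j) | j : 'I_N], forall u, P u}.
  by move=> u /mem_take/yP.
rewrite -(ll' _ tP) -ll' // => u; rewrite inE => /predU1P[->|/mem_drop/yP //].
exact: lP.
Qed.

Section Twist.
Variables (K : fieldType) (A B : lmodType K) (Q : quasi_twilled A B).
Variable r : {linear B -> A}.
Let E := seq (A * B) -> A * B.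

Lemma qt_mul_biadditive : biadditive (qt_mul Q).
Proof.
have mulE u v : qt_mul Q u v =
  qt_part Q 1 u v + qt_part Q 2 u v + qt_part Q 3 u v.
  by congr (_, _) => /=; [module_eq K A|module_eq K B].
by split=> a u v w; rewrite !mulE;
  rewrite !((qt_part_biadditive Q _).1, (qt_part_biadditive Q _).2);
  module_eq K (A * B)%type.
Qed.

(** The shear of [A (+) B] along [r] maps [B] onto the graph of [r]. *)
Definition shear (u : A * B) : A * B := (u.1 + r u.2, u.2).
Definition unshear (u : A * B) : A * B := (u.1 - r u.2, u.2).

Lemma shear_linear a u v : shear (a *: u + v) = a *: shear u + shear v.
Proof. by congr (_, _); rewrite /= linearP; module_eq K A. Qed.

Lemma unshear_linear a u v : unshear (a *: u + v) = a *: unshear u + unshear v.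
Proof. by congr (_, _); rewrite /= linearP; module_eq K A. Qed.

Lemma unshearK : cancel unshear shear.
Proof. by move=> [a x]; rewrite /shear /unshear /= subrK. Qed.

(** The product transported along the shear is quasi-twilled. *)
Lemma twist_exists : weak_deformation Q r ->
  exists Q' : quasi_twilled A B,
    forall u v, qt_mul Q' u v = unshear (qt_mul Q (shear u) (shear v)).
Proof.
move=> hr; pose m u v := unshear (qt_mul Q (shear u) (shear v)).
have mP : bilinear_for *:%R *:%R m.
  by split=> [w|w] a u v; rewrite /m /applyr /= shear_linear
    (qt_mul_biadditive.1, qt_mul_biadditive.2) unshear_linear.
pose mB := bilinear_isBilinear.Build K _ _ _ *:%R *:%R m mP.
pose mm : {bilinear (A * B)%type -> (A * B)%type -> (A * B)%type} := HB.pack m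
  mB.
have [|x y|Q' Q'E] := @qt_mul_surj _ _ _ mm.
- by move=> u v w; rewrite /= /m !unshearK qt_mulA.
- by rewrite /= /m /shear /= !add0r hr subrr.
by exists Q' => u v; rewrite Q'E.
Qed.

(** [f] as an endomorphism of [A (+) B], extended by zero. *)
Definition lift_map (f : B -> A) (u : A * B) : A * B := (f u.2, 0).

(** The bracket of a binary map with [f]. *)
Definition twist_by (f : B -> A) (b : A * B -> A * B -> A * B) (u v : A * B) :
  A * B :=
  b (lift_map f u) v + b u (lift_map f v) - lift_map f (b u v).

Lemma lift_map_linear (f : {linear B -> A}) a u v :
  lift_map f (a *: u + v) = a *: lift_map f u + lift_map f v.
Proof. by congr (_, _); rewrite /= ?linearP // scaler0 addr0. Qed.

Lemma b0_ofE (f : B -> A) : b0_of f = unary_map (lift_map f).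
Proof. by apply/funext => -[|u [|v s]]. Qed.

Lemma b0_of_graded (f : {linear B -> A}) : @b_graded K A B 0 (b0_of f).
Proof.
exists (unary_map f) => //; split=> [[|u [|v s]] //|s1 s2 a u v].
by case: s1 => [|x s1]; case: s2 => [|z s2] //=; rewrite ?addnS ?linearP //;
  lia.
Qed.

Lemma twist_by_biadditive (f : {linear B -> A}) b :
  biadditive b -> biadditive (twist_by f b).
Proof.
move=> [bl br]; split=> a u v w; rewrite /twist_by !(lift_map_linear, bl, br);
  by rewrite ?lift_map_linear; module_eq K (A * B)%type.
Qed.

Lemma gbracket_b0 (f : {linear B -> A}) b : biadditive b ->
  gbracket (binary_map b) (b0_of f) = binary_map (twist_by f b).
Proof.
by move=> bb; rewrite b0_ofE gbracket_unary //; exact: lift_map_linear.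
Qed.

Hypothesis two_neq0 : 2%:R != 0 :> K.

Lemma binary_mapE (b c : A * B -> A * B -> A * B) :
  (forall u v, b u v = c u v) -> binary_map b = binary_map c.
Proof. by move=> bc; apply/funext => -[|u [|v [|w s]]] //=. Qed.

Lemma binary_map_lin (a : K) (b c : A * B -> A * B -> A * B) :
  a *: binary_map b + binary_map c = binary_map (fun u v => a *: b u v + c u v).
Proof.
by apply/funext => -[|u [|v [|w s]]] //=; rewrite !fctE /= scaler0 addr0.
Qed.

Section Components.
Variable Q' : quasi_twilled A B.
Hypothesis Q'E : forall u v, qt_mul Q' u v =
  unshear (qt_mul Q (shear u) (shear v)).

Let simp := (linear0l, linear0r, linear0, addr0, add0r, subr0).

Lemma twist_mu a b : qt_mu Q' a b = qt_mu Q a b - r (qt_theta Q a b).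
Proof.
by have := congr1 fst (Q'E (a, 0) (b, 0)); rewrite /shear /= !simp.
Qed.

Lemma twist_theta a b : qt_theta Q' a b = qt_theta Q a b.
Proof.
by have := congr1 snd (Q'E (a, 0) (b, 0)); rewrite /shear /= !simp.
Qed.

Lemma twist_tr a y : qt_tr Q' a y = qt_tr Q a y + qt_theta Q a (r y).
Proof.
by have := congr1 snd (Q'E (a, 0) (0, y)); rewrite /shear /= !simp.
Qed.

Lemma twist_hl a y : qt_hl Q' a y =
  qt_mu Q a (r y) + qt_hl Q a y - r (qt_tr Q a y + qt_theta Q a (r y)).
Proof.
by have := congr1 fst (Q'E (a, 0) (0, y)); rewrite /shear /= !simp.
Qed.

Lemma twist_tl x b : qt_tl Q' x b = qt_tl Q x b + qt_theta Q (r x) b.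
Proof.
by have := congr1 snd (Q'E (0, x) (b, 0)); rewrite /shear /= !simp.
Qed.

Lemma twist_hr x b : qt_hr Q' x b =
  qt_mu Q (r x) b + qt_hr Q x b - r (qt_tl Q x b + qt_theta Q (r x) b).
Proof.
by have := congr1 fst (Q'E (0, x) (b, 0)); rewrite /shear /= !simp.
Qed.

Lemma twist_nu x y : qt_nu Q' x y =
  qt_nu Q x y + qt_tr Q (r x) y + qt_tl Q x (r y) + qt_theta Q (r x) (r y).
Proof.
by have := congr1 snd (Q'E (0, x) (0, y)); rewrite /shear /= !simp.
Qed.

Lemma twist_comp1 : qt_comp Q' 1 =
  qt_comp Q 1 + gbracket (qt_comp Q 2) (b0_of r)
  + 2%:R^-1 *: gbracket (gbracket (qt_comp Q 3) (b0_of r)) (b0_of r).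
Proof.
have b2 := qt_part_biadditive Q 2; have b3 := qt_part_biadditive Q 3.
rewrite /qt_comp (gbracket_b0 r b2) (gbracket_b0 r b3).
rewrite (gbracket_b0 r (twist_by_biadditive r b3)).
rewrite addrC -[_ + binary_map (twist_by _ _)]addrC
  -[binary_map (twist_by r (qt_part Q 2))]scale1r.
rewrite !binary_map_lin; apply: binary_mapE => -[a x] [b y].
congr (_, _) => /=; rewrite ?twist_hl ?twist_hr ?twist_nu !simp !linearD
  ?linearB /=.
  by module_coefs K A; repeat split; field.
by module_coefs K B; repeat split; field.
Qed.

Lemma twist_comp2 :
  qt_comp Q' 2 = qt_comp Q 2 + gbracket (qt_comp Q 3) (b0_of r).
Proof.
rewrite /qt_comp (gbracket_b0 r (qt_part_biadditive Q 3)).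
rewrite -[X in X + _]scale1r binary_map_lin; apply: binary_mapE => -[a x] [b y].
congr (_, _) => /=; rewrite ?twist_mu ?twist_tr ?twist_tl !simp.
  by module_eq K A.
by module_eq K B.
Qed.

Lemma twist_comp3 : qt_comp Q' 3 = qt_comp Q 3.
Proof. by apply: binary_mapE => u v /=; rewrite twist_theta. Qed.

Lemma qt_op_twisted s : {in s, forall f, slot_linear f} ->
  qt_op Q' s = l_twisted Q r s.
Proof.
case: s => [|f [|g [|h [|k s]]]] sl.
- by rewrite /qt_op /= qt_comp0.
- have fl : slot_linear f by apply: sl; rewrite inE.
  rewrite /qt_op /= twist_comp1 (gbracketDl _ _ fl) (gbracketDl _ _ fl).
  by rewrite (gbracketZl _ _ fl).
- have fl : slot_linear f by apply: sl; rewrite inE eqxx.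
  have gl : slot_linear g by apply: sl; rewrite !inE eqxx orbT.
  by rewrite /qt_op /= twist_comp2 (gbracketDl _ _ fl) (gbracketDl _ _ gl).
- by rewrite /qt_op /= twist_comp3.
rewrite /qt_op qt_comp_gt3 //=.
have := foldl_gbracket_lin (-1) 0 0 sl.
by rewrite scaler0 addr0 scaleN1r addNr.
Qed.

Lemma twisted_L_infinity : L_infinity_algebra (@b_graded K A B) (l_twisted Q r).
Proof.
apply: (L_infinity_transfer (P := @slot_linear K _ _) _ _ _ qt_op_twisted);
  last exact: quasi_twilled_L_infinity.
- by move=> u; apply: total_space_slot_linear => d g; exact: b_graded_slot.
- by move=> a u v ul vl s1 s2 c w t; rewrite !fctE ul vl;
  module_eq K (A * B)%type.
move=> s sl; apply: foldl_slot_linear => //.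
exact: multilinear_slot (qt_comp_multilinear _ _).
Qed.

Lemma weak_deformation_twist (r' : {linear B -> A}) :
  weak_deformation Q' r' <-> weak_deformation Q (r \+ r').
Proof.
have sE x : shear (r' x, x) = ((r \+ r') x, x) by congr (_, _);
  rewrite /= addrC.
split=> h x y.
  have : (qt_mul Q' (r' x, x) (r' y, y)).1 =
    r' (qt_mul Q' (r' x, x) (r' y, y)).2.
    exact: h.
  rewrite Q'E !sE [LHS]/= [X in _ = r' X]/= => h'.
  suff : (qt_mul Q ((r \+ r') x, x) ((r \+ r') y, y)).1 =
      (r \+ r') (qt_mul Q ((r \+ r') x, x) ((r \+ r') y, y)).2 by exact.
  by rewrite [RHS]/= addrC -h' subrK.
suff : (qt_mul Q' (r' x, x) (r' y, y)).1 = r' (qt_mul Q' (r' x, x) (r' y, y)).2.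
  by exact.
have hxy : (qt_mul Q ((r \+ r') x, x) ((r \+ r') y, y)).1 =
    (r \+ r') (qt_mul Q ((r \+ r') x, x) ((r \+ r') y, y)).2 by exact: h.
by rewrite Q'E !sE /unshear hxy [LHS]/= addrAC subrr add0r.
Qed.

End Components.
End Twist.

(** * Maurer-Cartan elements *)

Section MaurerCartan.
Variables (K : fieldType) (A B : lmodType K) (Q : quasi_twilled A B).
Hypothesis charK : [pchar K] =i pred0.

(** The Maurer-Cartan equation is the weak deformation equation. It only
    involves the operations on copies of the given element. *)
Lemma maurer_cartan_deformation (l : seq (seq (A * B) -> A * B) -> _)
  (r : {linear B -> A}) :
  (forall k, l (nseq k (b0_of r)) = qt_op Q (nseq k (b0_of r))) ->
  maurer_cartan (@b_graded K A B) l (b0_of r) <-> weak_deformation Q r.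
Proof.
move=> lE; set a := b0_of r.
have nat_neq0 n : (n.+1)%:R != 0 :> K by rewrite ((pcharf0P K).1 charK).
have al : slot_linear a by apply: b_graded_slot (b0_of_graded r).
have l_gt3 k : (3 < k)%N -> l (nseq k a) = 0.
  move=> k3; rewrite lE /qt_op size_nseq qt_comp_gt3 //.
  have nl : {in nseq k a, forall g, slot_linear g} by move=> g /nseqP[->].
  by have := foldl_gbracket_lin (-1) 0 0 nl;
    rewrite scaler0 addr0 scaleN1r addNr.
pose S n := \sum_(1 <= k < n.+1) (k`!%:R)^-1 *: l (nseq k a).
have SE m n : (m <= n)%N -> (forall k, (m < k)%N -> l (nseq k a) = 0) ->
  S n = S m.
  move=> mn h; rewrite /S (big_cat_nat (n := m.+1)) //=.
  rewrite [X in _ + X](_ : _ = 0) ?addr0 // big_nat;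
    apply: big1 => k /andP[mk _].
  by rewrite h ?scaler0.
have mcE : maurer_cartan (@b_graded K A B) l a <-> S 3 = 0.
  split=> [[_ [n [n0 nS]]]|S3]; last by split; [exact: b0_of_graded|exists 3].
  have [n3|n3] := leqP n 3; first by rewrite (SE n).
  by rewrite -(SE 3 n) // ltnW.
apply: (iff_trans mcE); rewrite /S.
have [b1 b2 b3] : [/\ biadditive (qt_part Q 1),
  biadditive (qt_part Q 2) & biadditive (qt_part Q 3)].
  by split; exact: qt_part_biadditive.
have t2 := twist_by_biadditive r b2.
have t3 := twist_by_biadditive r b3.
have t33 := twist_by_biadditive r t3.
have -> : \sum_(1 <= k < 4) (k`!%:R)^-1 *: l (nseq k a) =
  binary_map (fun u v => (qt_mu Q (r u.2) (r v.2) + qt_hl Q (r u.2) v.2 + qt_hr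
    Q u.2 (r v.2)
    - r (qt_nu Q u.2 v.2 + qt_tr Q (r u.2) v.2 + qt_tl Q u.2 (r v.2)
       + qt_theta Q (r u.2) (r v.2)), 0)).
  under eq_bigr => k _ do rewrite lE /qt_op size_nseq.
  rewrite unlock /= /qt_comp /a.
  rewrite (gbracket_b0 r b1) (gbracket_b0 r b2) (gbracket_b0 r b3).
  rewrite (gbracket_b0 r t2) (gbracket_b0 r t3) (gbracket_b0 r t33).
  rewrite (_ : 0 = binary_map (fun _ _ => 0)); last first.
    by apply/funext => -[|u [|v [|w s]]].
  rewrite !binary_map_lin; apply: binary_mapE => -[a1 x] [b y].
  rewrite (_ : 1`! = 1%N) // (_ : 2`! = 2%N) // (_ : 3`! = 6%N) // invr1.
  congr (_, _) => /=; rewrite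
    !(linear0l, linear0r, linear0, addr0, add0r, subr0, subrr, oppr0,
    scaler0) //.
  rewrite !linearD /=.
  by module_coefs K A; repeat split; field; rewrite ?nat_neq0.
split=> [h x y|h].
  have /(congr1 fst) /= := congr1 (fun f => f [:: (0, x); (0, y)]) h.
  by move/eqP; rewrite subr_eq0 => /eqP.
rewrite (_ : 0 = binary_map (fun _ _ => 0)); last first.
  by apply/funext => -[|u [|v [|w s]]].
by apply: binary_mapE => u v; rewrite h subrr.
Qed.

End MaurerCartan.

(** * The twisted algebra and its Maurer-Cartan elements *)

Theorem theorem7p3 (K : fieldType) (charK : [pchar K] =i pred0)
    (A B : lmodType K) (Q : quasi_twilled A B) (r : {linear B -> A})
    (hr : weak_deformation Q r) :
  L_infinity_algebra (E := seq (A * B) -> A * B)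
    (@b_graded K A B) (l_twisted Q r) /\
  forall r' : {linear B -> A},
    weak_deformation Q (r \+ r') <->
    maurer_cartan (E := seq (A * B) -> A * B)
      (@b_graded K A B) (l_twisted Q r) (b0_of r').
Proof.
have two_neq0 : 2%:R != 0 :> K by rewrite ((pcharf0P K).1 charK).
have [Q' Q'E] := twist_exists hr.
split; first exact: twisted_L_infinity Q'E.
move=> r'; apply: iff_sym.
apply: iff_trans (weak_deformation_twist Q'E r').
apply: maurer_cartan_deformation => // k.
rewrite -(qt_op_twisted two_neq0 Q'E) // => g /nseqP[-> _].
exact: b_graded_slot (b0_of_graded r').
Qed.
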